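(* Consider the CPE-B problem in the fixed-confidence setting with $n$ base arms, $R$-sub-Gaussian rewards and decision class $\mathcal{M}$. For any $\delta<0.01$ ($\delta>0$), with probability at least $1-\delta$, algorithm BLUCB-Parallel returns $M_*$ and takes the expected sample complexity $$O\left(\sum_{e\in M_*\cup N}\frac{R^2}{(\Delta^{C}_e)^2}\ln\left(\frac1\delta\sum_{e\in M_*\cup N}\frac{R^2n}{(\Delta^{C}_e)^2}\right)+\sum_{e\in\tilde N}\frac{R^2}{(\Delta^{C}_e)^2}\ln\left(\sum_{e\in\tilde N}\frac{R^2n}{(\Delta^{C}_e)^2}\right)\right).$$
   Context: CPE-B (combinatorial pure exploration with bottleneck reward). There are $n$ base arms $[n]=\{1,\dots,n\}$. Each base arm $e$ has an unknown reward distribution with mean $w(e)$ and an $R$-sub-Gaussian tail ($R>0$): if $X$ is a random reward of $e$, then $\mathbb{E}[\exp(\lambda(X-w(e)))]\le\exp(\lambda^2R^2/2)$ for all $\lambda\in\mathbb{R}$. Write $\boldsymbol{w}=(w(1),\dots,w(n))$. A decision class $\mathcal{M}\subseteq 2^{[n]}$ of super arms (nonempty subsets of $[n]$) is given. For $M\in\mathcal{M}$ and $\boldsymbol{v}\in\mathbb{R}^n$ let $\mathrm{MinW}(M,\boldsymbol{v})=\min_{e\in M}v(e)$. The optimal super arm $M_*=\operatorname{argmax}_{M\in\mathcal{M}}\mathrm{MinW}(M,\boldsymbol{w})$ is assumed unique, and $\mathrm{OPT}=\mathrm{MinW}(M_*,\boldsymbol{w})$. At each timestep the learner plays one base arm and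 observes an independent sample of its reward. In the fixed-confidence setting the goal is to identify $M_*$ with probability at least $1-\delta$; the sample complexity is the number of samples used. Gaps. Let $N=\{e: e\notin M_*, w(e)<\mathrm{OPT}\}$ and $\tilde N=\{e: e\notin M_*, w(e)\ge \mathrm{OPT}\}$. Define $\Delta^{C}_e=w(e)-\max_{M\in\mathcal{M},M\ne M_*}\mathrm{MinW}(M,\boldsymbol{w})$ if $e\in M_*$; $\Delta^{C}_e=w(e)-\max_{M\in\mathcal{M}:e\in M}\mathrm{MinW}(M,\boldsymbol{w})$ if $e\in\tilde N$; $\Delta^{C}_e=\mathrm{OPT}-\max_{M\in\mathcal{M}:e\in M}\mathrm{MinW}(M,\boldsymbol{w})$ if $e\in N$. (Maximum over the empty set is $-\infty$, $1/\infty^2=0$, and $0\ln 0=0$.) Common notation. $\mathcal{S}(M)$ is the set of all supersets of $M$ (including $M$). $\mathrm{MaxOracle}(\mathcal{F},\boldsymbol{v})$ returns an element of $\operatorname{argmax}_{M\in\mathcal{F}}\mathrm{MinW}(M,\boldsymbol{v})$. $\mathrm{BottleneckSearch}(\mathcal{M},M,\boldsymbol{v})$ returns a set $A_{\rm out}\subseteq[n]$ such that (i) for every $M'\in\mathcal{M}\setminus\mathcal{S}(M)$ there is $e\in A_{\rm out}\cap M'$ with $v(e)=\mathrm{MinW}(M',\boldsymbol{v})$, and (ii) for every $e\in A_{\rm out}$ there is $M'\in\mathcal{M}\setminus\mathcal{S}(M)$ with $e\in M'$ and $v(e)=\mathrm{MinW}(M',\boldsymbol{v})$. In each routine below, $T_t(e)$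 is the number of samples of $e$ taken by that routine's loop (with its initialization) before round $t$, and $\hat w_t(e)$ is their empirical mean; with a confidence parameter $\eta$, $\mathrm{rad}_t(e)=R\sqrt{2\ln(4nt^3/\eta)/T_t(e)}$, $\underline{w}_t=\hat w_t-\mathrm{rad}_t$, $\bar w_t=\hat w_t+\mathrm{rad}_t$. BLUCB-Explore (parameter $\eta=\kappa=0.01$). Play each base arm once. For $t=n+1,n+2,\dots$: $M_t=\mathrm{MaxOracle}(\mathcal{M},\underline{\boldsymbol{w}}_t)$, $\hat B_{\mathrm{sub},t}=\mathrm{BottleneckSearch}(\mathcal{M},M_t,\underline{\boldsymbol{w}}_t)$. If $\bar w_t(e)\le\frac12(\mathrm{MinW}(M_t,\underline{\boldsymbol{w}}_t)+\underline{w}_t(e))$ for all $e\in\hat B_{\mathrm{sub},t}$, return $(M_t,\hat B_{\mathrm{sub},t})$. Otherwise let $c_t\in\operatorname{argmin}_{e\in M_t}\underline{w}_t(e)$, $\hat B'_{\mathrm{sub},t}=\{e\in\hat B_{\mathrm{sub},t}:\bar w_t(e)>\frac12(\mathrm{MinW}(M_t,\underline{\boldsymbol{w}}_t)+\underline{w}_t(e))\}$, and play $p_t\in\operatorname{argmax}_{e\in\hat B'_{\mathrm{sub},t}\cup\{c_t\}}\mathrm{rad}_t(e)$. BLUCB-Verify (parameter $\eta=\delta^V$). First run BLUCB-Explore and get its output $(\hat M_*,\hat B_{\mathrm{sub}})$. Then, with fresh samples, play each base arm once, and for $t=n+1,n+2,\dots$: $\tilde M_t=\mathrm{MaxOracle}(\mathcal{M}\setminus\mathcal{S}(\hat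 M_* ),\bar{\boldsymbol{w}}_t)$. If $\mathrm{MinW}(\hat M_*,\underline{\boldsymbol{w}}_t)\ge\mathrm{MinW}(\tilde M_t,\bar{\boldsymbol{w}}_t)$ (or $\mathcal{M}\setminus\mathcal{S}(\hat M_* )=\varnothing$), return $\hat M_*$. Otherwise let $c_t\in\operatorname{argmin}_{e\in\hat M_*}\underline{w}_t(e)$, $F_t=\{e\in\hat B_{\mathrm{sub}}:\bar w_t(e)>\underline{w}_t(c_t)\}$, and play $p_t\in\operatorname{argmax}_{e\in F_t\cup\{c_t\}}\mathrm{rad}_t(e)$. BLUCB-Parallel (parameter $\delta$). For $k=0,1,\dots$ let BLUCB-Verify$_k$ be a copy of BLUCB-Verify with $\delta^V=\delta/2^{k+1}$. For $t=1,2,\dots$ and each $k\ge0$ with $2^k\mid t$: start or resume BLUCB-Verify$_k$ for one sample and then suspend it; if BLUCB-Verify$_k$ returns an answer, stop and return that answer. Its sample complexity counts the samples of all copies.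
   Formalization: The expected sample complexity is bounded by a universal constant times n plus the stated bracket, not the bracket alone: if M* is the only super arm, all gaps are infinite and the bracket is 0, yet playing each base arm once in both phases already costs 2n samples. *)

(* Defs.v *)
From HB Require Import structures.
From mathcomp Require Import all_boot all_order all_algebra.
From mathcomp Require Import all_classical all_reals all_analysis.

Set Implicit Arguments.
Unset Strict Implicit.
Unset Printing Implicit Defensive.

Import Order.TTheory GRing.Theory Num.Theory.
Import numFieldNormedType.Exports.

Local Open Scope classical_set_scope.
Local Open Scope ring_scope.

Definition has_mean (R : realType) (nu : probability R R) (m : R) : Prop :=
  nu.-integrable [set: R] (fun x => x%:E) /\ (\int[nu]_x x%:E = m%:E)%E.

Definition sub_gaussian (R : realType) (nu : probability R R) (m sg : R) : Prop :=
  forall lam : R,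
    (\int[nu]_x (expR (lam * (x - m)))%:E
       <= (expR (lam ^+ 2 * sg ^+ 2 / 2))%:E)%E.

Definition mutually_independent d (T : measurableType d) (R : realType)
    (P : probability T R) (I : eqType) (X : I -> {RV P >-> R}) : Prop :=
  forall (s : seq I) (B : I -> set R),
    uniq s -> (forall i, measurable (B i)) ->
    P (\big[setI/setT]_(i <- s) (X i @^-1` B i)) =
      (\prod_(i <- s) P (X i @^-1` B i))%E.

(* [X s e] is the reward that base arm [e] yields if it is the arm played at
   timestep [s]; the learner only observes [X s e] for the arm it plays. *)
Definition reward_process (R : realType) (n : nat) (nu : 'I_n -> probability R R)
    d (T : measurableType d) (P : probability T R)
    (X : nat -> 'I_n -> {RV P >-> R}) : Prop :=
  (forall s e (B : set R), measurable B -> distribution P (X s e) B = nu e B) /\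
  mutually_independent (fun i : nat * 'I_n => X i.1 i.2).

Section Bottleneck.
Context (R : realType) (n : nat).
Implicit Types (M : {set 'I_n}) (F : {set {set 'I_n}}) (v : 'I_n -> R).

(* Extended reals make the conventions on empty sets literal: [minW] is finite
   on nonempty super arms, and [maxW] of an empty family is [-oo]. *)
Definition minW M v : \bar R := \big[mine/+oo%E]_(e in M) (v e)%:E.

Definition maxW F v : \bar R := \big[maxe/-oo%E]_(M in F) minW M v.

Definition supersets M : {set {set 'I_n}} := [set M' : {set 'I_n} | M \subset M'].

Definition unique_optimum F v M : Prop :=
  M \in F /\ forall M', M' \in F -> M' != M -> (minW M' v < minW M v)%E.

Section Gaps.
Variables (F : {set {set 'I_n}}) (Mstar : {set 'I_n}) (w : 'I_n -> R).

Definition setN : {set 'I_n} :=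
  [set e | (e \notin Mstar) && ((w e)%:E < minW Mstar w)%E].

Definition setNt : {set 'I_n} :=
  [set e | (e \notin Mstar) && (minW Mstar w <= (w e)%:E)%E].

Definition gap (e : 'I_n) : \bar R :=
  if e \in Mstar then ((w e)%:E - maxW (F :\ Mstar) w)%E
  else if (minW Mstar w <= (w e)%:E)%E
       then ((w e)%:E - maxW [set M in F | e \in M] w)%E
       else (minW Mstar w - maxW [set M in F | e \in M] w)%E.

Definition hardness (sg : R) (A : {set 'I_n}) : \bar R :=
  (\sum_(e in A) ((sg ^+ 2)%:E / (gap e ^+ 2)))%E.

(* In [\bar R], [x / +oo = 0], [lne 0 = -oo] and [0 * -oo = 0], so the
   conventions 1/oo^2 = 0 and 0 ln 0 = 0 hold as they stand. *)
Definition complexity (sg delta : R) : \bar R :=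
  let H1 := hardness sg (Mstar :|: setN) in
  let H2 := hardness sg setNt in
  (H1 * lne (delta^-1%:E * (n%:R%:E * H1)) + H2 * lne (n%:R%:E * H2))%E.

End Gaps.

(* Each routine may break ties in any way; [arg_min A v] and [arg_max A v] are
   the choices made when an argmin or argmax of [v] over [A] is needed. *)
Record subroutines := Subroutines {
  max_oracle : {set {set 'I_n}} -> ('I_n -> R) -> {set 'I_n};
  bottleneck_search :
    {set {set 'I_n}} -> {set 'I_n} -> ('I_n -> R) -> {set 'I_n};
  arg_min : {set 'I_n} -> ('I_n -> R) -> 'I_n;
  arg_max : {set 'I_n} -> ('I_n -> R) -> 'I_n }.

Definition max_oracle_spec (mo : {set {set 'I_n}} -> ('I_n -> R) -> {set 'I_n}) :=
  forall F v, F != finset.set0 ->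
    mo F v \in F /\ forall M, M \in F -> (minW M v <= minW (mo F v) v)%E.

Definition bottleneck_search_spec
    (bs : {set {set 'I_n}} -> {set 'I_n} -> ('I_n -> R) -> {set 'I_n}) :=
  forall F M v, finset.set0 \notin F ->
    (forall M', M' \in F :\: supersets M ->
       exists e, [/\ e \in bs F M v, e \in M' & (v e)%:E = minW M' v]) /\
    (forall e, e \in bs F M v ->
       exists M', [/\ M' \in F :\: supersets M, e \in M' & (v e)%:E = minW M' v]).

Definition arg_min_spec (am : {set 'I_n} -> ('I_n -> R) -> 'I_n) :=
  forall A v, A != finset.set0 ->
    am A v \in A /\ forall e, e \in A -> v (am A v) <= v e.

Definition arg_max_spec (am : {set 'I_n} -> ('I_n -> R) -> 'I_n) :=
  forall A v, A != finset.set0 ->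
    am A v \in A /\ forall e, e \in A -> v e <= v (am A v).

(* Borel sets of the space of vectors [v : 'I_n -> R]. *)
Definition vec_measurable : set (set ('I_n -> R)) :=
  g_sigma_preimage (fun (i : 'I_n) (v : 'I_n -> R) => v i).

(* Ties may have positive probability, so Borel tie-breaking is required for the
   behaviour of the algorithm to be a random object. *)
Definition subroutines_measurable (sub : subroutines) : Prop :=
  [/\ forall F M, vec_measurable [set v | max_oracle sub F v = M],
      forall F M A, vec_measurable [set v | bottleneck_search sub F M v = A],
      forall A e, vec_measurable [set v | arg_min sub A v = e] &
      forall A e, vec_measurable [set v | arg_max sub A v = e]].

Definition subroutines_spec (sub : subroutines) : Prop :=
  [/\ max_oracle_spec (max_oracle sub),
      bottleneck_search_spec (bottleneck_search sub),
      arg_min_spec (arg_min sub) & arg_max_spec (arg_max sub)].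

End Bottleneck.

Inductive action (n : nat) (A : Type) := Play of 'I_n | Return of A.

Arguments Play {n A}.
Arguments Return {n A}.

Section Algorithms.
Context (R : realType) (n : nat).
Variables (F : {set {set 'I_n}}) (sg : R) (sub : subroutines R n).

(* The plays and observations of one routine, oldest first. One base arm is
   played per round, initialization included, so a routine whose history is [h]
   is about to execute round [(size h).+1]. *)
Definition history := seq ('I_n * R).

Section Confidence.
Variables (eta : R) (h : history).

Definition nb_plays (e : 'I_n) : nat := count (fun p => p.1 == e) h.

Definition emp_mean (e : 'I_n) : R :=
  (\sum_(p <- h | p.1 == e) p.2) / (nb_plays e)%:R.

Definition rad (e : 'I_n) : R :=
  sg * Num.sqrt (2 * ln (4 * n%:R * (size h).+1%:R ^+ 3 / eta) / (nb_plays e)%:R).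

Definition lcb (e : 'I_n) : R := emp_mean e - rad e.
Definition ucb (e : 'I_n) : R := emp_mean e + rad e.

End Confidence.

(* [insub (size h)] is the base arm to be initialized next, if any is left. *)

Definition explore_loop (h : history) : action n ({set 'I_n} * {set 'I_n}) :=
  let lo := lcb (100%:R^-1) h in
  let up := ucb (100%:R^-1) h in
  let M := max_oracle sub F lo in
  let B := bottleneck_search sub F M lo in
  let threshold e := (2^-1%:E * (minW M lo + (lo e)%:E))%E in
  if [forall e in B, ((up e)%:E <= threshold e)%E] then Return (M, B)
  else
    let c := arg_min sub M lo in
    let B' := [set e in B | (threshold e < (up e)%:E)%E] in
    Play (arg_max sub (c |: B') (rad (100%:R^-1) h)).

Definition explore (h : history) : action n ({set 'I_n} * {set 'I_n}) :=
  if insub (size h) is Some e then Play e else explore_loop h.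

Definition verify_loop (deltaV : R) (Mhat Bsub : {set 'I_n}) (h : history) :
    action n {set 'I_n} :=
  let lo := lcb deltaV h in
  let up := ucb deltaV h in
  let G := F :\: supersets Mhat in
  let Mt := max_oracle sub G up in
  if (G == finset.set0) || (minW Mt up <= minW Mhat lo)%E then Return Mhat
  else
    let c := arg_min sub Mhat lo in
    let Ft := [set e in Bsub | lo c < up e] in
    Play (arg_max sub (c |: Ft) (rad deltaV h)).

Definition verify_fresh (deltaV : R) (Mhat Bsub : {set 'I_n}) (h : history) :
    action n {set 'I_n} :=
  if insub (size h) is Some e then Play e else verify_loop deltaV Mhat Bsub h.

(* A suspended BLUCB-Verify: either its BLUCB-Explore is still running, or the
   latter has returned and fresh samples are being collected. *)
Inductive verify_state :=
  | Exploring of history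
  | Verifying of {set 'I_n} & {set 'I_n} & history.

Inductive resumption :=
  | Answer of {set 'I_n}
  | Sample of 'I_n & (R -> verify_state).

Definition resume_fresh (deltaV : R) (Mhat Bsub : {set 'I_n}) (h : history) :
    resumption :=
  match verify_fresh deltaV Mhat Bsub h with
  | Return M => Answer M
  | Play e => Sample e (fun x => Verifying Mhat Bsub (rcons h (e, x)))
  end.

(* BLUCB-Verify resumed from state [s], up to its next sample or its answer. When
   BLUCB-Explore returns, the verification phase starts without any sample. *)
Definition resume (deltaV : R) (s : verify_state) : resumption :=
  match s with
  | Exploring h =>
      match explore h with
      | Play e => Sample e (fun x => Exploring (rcons h (e, x)))
      | Return (Mhat, Bsub) => resume_fresh deltaV Mhat Bsub [::]
      end
  | Verifying Mhat Bsub h => resume_fresh deltaV Mhat Bsub h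
  end.

Record parallel_state := ParallelState {
  copies : nat -> verify_state;
  nb_samples : nat;
  answer : option {set 'I_n} }.

Definition parallel_init : parallel_state :=
  ParallelState (fun=> Exploring [::]) 0 None.

(* [x s e] is the value of the reward of arm [e] at timestep [s]. *)
Definition parallel_slot (delta : R) (x : nat -> 'I_n -> R)
    (st : parallel_state) (k : nat) : parallel_state :=
  if answer st is Some _ then st
  else match resume (delta / 2 ^+ k.+1) (copies st k) with
  | Answer M => ParallelState (copies st) (nb_samples st) (Some M)
  | Sample e next =>
      ParallelState
        (fun j => if j == k then next (x (nb_samples st) e) else copies st j)
        (nb_samples st).+1 None
  end.

(* State after rounds 1, ..., [t]; [2 ^ k %| t] forces [k < t] when [0 < t]. *)
Fixpoint parallel_run (delta : R) (x : nat -> 'I_n -> R) (t : nat) :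
    parallel_state :=
  if t is t'.+1 then
    foldl (parallel_slot delta x) (parallel_run delta x t')
      [seq k <- iota 0 t | (2 ^ k %| t)%N]
  else parallel_init.

Definition parallel_returns (delta : R) (x : nat -> 'I_n -> R) (M : {set 'I_n}) :
    Prop :=
  exists t, answer (parallel_run delta x t) = Some M.

(* [+oo] on runs that never stop. *)
Definition parallel_samples (delta : R) (x : nat -> 'I_n -> R) : \bar R :=
  ereal_sup [set (nb_samples (parallel_run delta x t))%:R%:E | t in [set: nat]].

End Algorithms.

(* Main.v *)
(* Proof idea.  A copy of BLUCB-Verify is well estimated when the true means never
   leave the confidence intervals of its two phases.  In that case every arm [p]
   played after the initialization satisfies [gap p <= 8 * rad p], exploration
   returns [Mstar] with a set of bottlenecks that avoids the arms of [setNt], and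
   verification then only plays arms of [Mstar :|: setN].  Counting plays turns
   this into a bound, proportional to [k.+1], on the samples of copy [k].
   The failure of copy [k] forces a nonnegative supermartingale, a weighted sum
   over arms and sample sizes of Chernoff exponentials, to reach 1.  Summing the
   verification parts over the copies bounds the probability of a wrong answer by
   [delta / 2].  The product over the copies [0, ..., k] is still a
   supermartingale, so all of them fail with probability at most [100 ^- k.+1],
   whereas otherwise the algorithm stops before [2 ^ k * O(k.+1)] rounds. *)
Require Import Defs.
From HB Require Import structures.
From mathcomp Require Import all_boot all_order all_algebra.
From mathcomp Require Import all_classical all_reals all_analysis.
From mathcomp Require Import measurable_realfun lra ring zify.

Set Implicit Arguments.
Unset Strict Implicit.
Unset Printing Implicit Defensive.

Import Order.TTheory GRing.Theory Num.Theory.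
Import numFieldNormedType.Exports.

Local Open Scope classical_set_scope.
Local Open Scope ring_scope.

(** * Logarithmic estimates *)

(** Each Chernoff exponential is frozen once its arm has the prescribed number of samples, so its
    value at the end of a run still witnesses a deviation at any earlier round; the maximal
    inequality thereby reduces to Markov's inequality at the last slot. The obstacle is that all
    copies read one stream of rewards, at timesteps that depend on the past. Runs are therefore
    replayed on symbolic states, which store timesteps instead of rewards: no sigma-algebra on
    histories is needed, and each step integrates a single reward that is independent of the past.
    Correctness of an answer rests on the verification intervals alone. Exploration may fail with
    constant probability without harming it, which is why the arms of [setNt] pay no
    [ln (1 / delta)]. The failure level [1 / 100] of a copy has to beat the doubling of the rounds:
    a time of order [2 ^ k * k] is charged with a probability of order [100 ^- k]. The series
    converges, so the bound holds for the expectation over all runs, not only over the successful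
    ones. *)

Section LogBounds.
Context {R : realType}.
Implicit Types h x y : R.

Lemma ln_le_sub1 x : 0 < x -> ln x <= x - 1.
Proof.
move=> x0; have := @le_ln1Dx R (x - 1); rewrite [1 + _]addrC subrK.
by apply; lra.
Qed.

Lemma ln_mul x y : 0 < x -> 0 < y -> ln (x * y) = ln x + ln y.
Proof. by move=> x0 y0; rewrite lnM ?posrE. Qed.

(* [ln] takes the junk value 0 at 0, so [h * ln h] has the right value there. *)
Lemma le_xlnx_add1 h : 0 <= h -> h <= h * ln h + 1.
Proof.
rewrite le_eqVlt => /predU1P[<-|h0]; first by rewrite mul0r; lra.
have y0 : 0 < h^-1 by rewrite invr_gt0.
have := ln_le_sub1 y0; rewrite lnV ?posrE// -(ler_pM2l h0).
by rewrite mulrBr mulfV ?gt_eqF//; lra.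
Qed.

Lemma ln2_le1 : ln 2 <= 1 :> R.
Proof. by have := @ln_le_sub1 2; lra. Qed.

(** [le_xlnx_add1] at [2 * h], where [ln 2 <= 1] absorbs the extra term. *)
Lemma xlnx_ge_half h : 0 <= h -> - 2^-1 <= h * ln h.
Proof.
rewrite le_eqVlt => /predU1P[<-|h0]; first by rewrite mul0r; lra.
have := @le_xlnx_add1 (2 * h); rewrite ln_mul// => /(_ _).
have := ln2_le1; have -> : 2 * h * (ln 2 + ln h) = 2 * (h * ln 2) + 2 * (h * ln h) by lra.
rewrite -(ler_pM2l h0) => ? le1.
have {}le1 := le1 (ltW (mulr_gt0 _ h0)); have := le1 ltac:(by []); lra.
Qed.

(** Exploration is charged the total hardness [h1 + h2], while the target has one logarithm per sum;
    this separates them at linear cost, through [ln (1 + y / x) <= y / x]. *)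
Lemma xlnx_add h1 h2 : 0 <= h1 -> 0 <= h2 ->
  (h1 + h2) * ln (h1 + h2) <= h1 * ln h1 + h2 * ln h2 + (h1 + h2).
Proof.
suff half x y : 0 <= x -> 0 <= y -> x * ln (x + y) <= x * ln x + y.
  by move=> h10 h20; have := half _ _ h10 h20; have := half _ _ h20 h10;
    rewrite [h2 + h1]addrC; lra.
rewrite le_eqVlt => /predU1P[<-|x0] y0; first by rewrite !mul0r; lra.
have -> : x + y = x * (1 + y / x) by field; lra.
have yx : 0 <= y / x by rewrite divr_ge0// ltW.
rewrite ln_mul//; last lra.
have yx1 : 0 < 1 + y / x by lra.
have := ln_le_sub1 yx1.
rewrite -(ler_pM2l x0) => le1.
have : x * (y / x) = y by field; lra.
by lra.
Qed.

Lemma ln_ge_sub x : 0 < x -> 1 - x^-1 <= ln x.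
Proof.
move=> x0; have := @ln_le_sub1 x^-1; rewrite invr_gt0 lnV ?posrE// => /(_ x0).
lra.
Qed.

Lemma ln_ge1 x : 100 <= x -> 1 <= ln x.
Proof.
move=> x100; have ten : 10^-1 = (1/10 : R) by lra.
(* [ln_ge_sub] never yields 1 on its own, but two factors of at least 10 contribute [9 / 10]
   each. *)
have -> : x = 10 * (x / 10) by field.
rewrite ln_mul//; last lra.
have := @ln_ge_sub 10; have := @ln_ge_sub (x / 10).
have : (x / 10)^-1 <= 10^-1 by rewrite lef_pV2 ?posrE; lra.
lra.
Qed.

Lemma ln_ratio_ge1 (n : nat) (eta : R) : (0 < n)%N -> 0 < eta <= 100%:R^-1 ->
  1 <= ln (n%:R / eta).
Proof.
move=> n0 /andP[e0 e1]; apply: ln_ge1.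
have ie : 100 <= eta^-1 by rewrite -[100]invrK lef_pV2// posrE ?invr_gt0.
have n1 : 1 <= n%:R :> R by rewrite ler1n.
by nra.
Qed.

(** Solves an inequality that has [m] inside the logarithm as well. There [ln m] carries the factor
    [3 * 128 * h]; giving up half of [m] for it leaves [768 * (h * ln h)] and a multiple of [h],
    absorbed by [h * ln (n / eta)] because that logarithm is at least 1. *)
Lemma log_recursion (n m : nat) (eta h : R) :
  (0 < n)%N -> (0 < m)%N -> 0 < eta <= 100%:R^-1 -> 0 <= h ->
  m%:R <= n%:R + 128 * h * ln (4 * n%:R * m%:R ^+ 3 / eta) ->
  m%:R <= 2 * n%:R + 9000 * (h * ln (n%:R / eta)) + 768 * (h * ln h).
Proof.
move=> n0 m0 eta1; have l1 := ln_ratio_ge1 n0 eta1; have /andP[e0 _] := eta1.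
have n1 : 1 <= n%:R :> R by rewrite ler1n.
have mR : 0 < m%:R :> R by rewrite ltr0n.
have -> : 4 * n%:R * m%:R ^+ 3 / eta = 2 * 2 * (n%:R / eta) * (m%:R ^+ 3) :> R.
  by field; lra.
have l0 : 0 < n%:R / eta by rewrite divr_gt0//; lra.
have m30 : 0 < m%:R ^+ 3 :> R by rewrite exprn_gt0.
have l20 : 0 < 2 * 2 * (n%:R / eta) by lra.
rewrite (ln_mul l20 m30) (@ln_mul (2 * 2))// (@ln_mul 2 2)// lnXn//.
rewrite le_eqVlt => /predU1P[<-|h0]; first by rewrite !(mulr0, mul0r); lra.
move: l1; set l := ln (n%:R / eta) => l1.
have [c cE] : exists c : R, c = 768 by exists 768.
have c0 : 0 < c by lra.
have y0 : 0 < m%:R / (c * h) by rewrite divr_gt0// mulr_gt0.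
have lnc : ln c <= 10.
  have : ln c <= ln (2 ^+ 10) by rewrite ler_ln ?posrE ?exprn_gt0//; lra.
  by rewrite lnXn//; have := ln2_le1; lra.
(* [ln m] is bounded with slope [1 / (768 h)] so that half of [m] is absorbed. *)
have lnm : ln m%:R <= m%:R / (c * h) + 10 + ln h.
  have -> : ln m%:R = ln (m%:R / (c * h)) + (ln c + ln h).
    by rewrite -(ln_mul c0 h0) -(ln_mul y0 (mulr_gt0 c0 h0)) divfK// gt_eqF// mulr_gt0.
  by have := ln_le_sub1 y0; lra.
have : 384 * (h * ln m%:R) <= m%:R / 2 + 3840 * h + 384 * (h * ln h).
  have : h * ln m%:R <= h * (m%:R / (c * h) + 10 + ln h) by rewrite ler_pM2l.
  have : c * (h * (m%:R / (c * h))) = m%:R by field; rewrite !gt_eqF.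
  rewrite cE.
  lra.
have : h * ln 2 <= h by rewrite -[leRHS]mulr1 ler_pM2l// ln2_le1.
have : h <= h * l by rewrite -[leLHS]mulr1 ler_pM2l.
lra.
Qed.

Lemma log_arg_ge0 (n k : nat) (eta : R) : (0 < n)%N -> (0 < k)%N ->
  0 < eta <= 100%:R^-1 -> 0 <= ln (4 * n%:R * k%:R ^+ 3 / eta) :> R.
Proof.
move=> n0 k0 /andP[e0 e1]; apply: ln_ge0.
have n1 : 1 <= n%:R :> R by rewrite ler1n.
have k1 : 1 <= k%:R ^+ 3 :> R by rewrite exprn_ege1// ler1n.
have ie : 1 <= eta^-1 by rewrite -[1]invrK lef_pV2 ?posrE ?invr_gt0//; lra.
rewrite -[1]mulr1 ler_pM// -[1]mulr1 ler_pM//; lra.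
Qed.

(** Instance [m = 1] of [log_recursion]. It serves for empty histories, where positivity of the
    bound is not obvious since [h * ln h] can be negative. *)
Lemma log_bound_ge1 (n : nat) (eta h : R) : (0 < n)%N ->
  0 < eta <= 100%:R^-1 -> 0 <= h ->
  1 <= 2 * n%:R + 9000 * (h * ln (n%:R / eta)) + 768 * (h * ln h).
Proof.
move=> n0 eta1 h0; apply: (@log_recursion n 1 eta h) => //.
have n1 : 1 <= n%:R :> R by rewrite ler1n.
by have := mulr_ge0 h0 (log_arg_ge0 n0 (ltn0Sn 0) eta1); lra.
Qed.

(** [Q] will be [n] plus the complexity. As the terms [h * ln h] may be negative, [Q] is first
    bounded away from 0, which then lets it absorb constants. The left-hand side adds exploration at
    level [1 / 100] on the total hardness and verification by copy [k] on [h1]; the factor [k.+1]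
    pays for [ln (2 ^+ k.+1)]. *)
Lemma sample_bounds (n k : nat) (delta h1 h2 Q h : R) : (0 < n)%N ->
  0 < delta < 100%:R^-1 -> 0 <= h1 -> 0 <= h2 ->
  Q = n%:R + (h1 * ln (delta^-1 * (n%:R * h1)) + h2 * ln (n%:R * h2)) ->
  h = h1 + h2 ->
  1 <= 4 * Q /\
  2 * n%:R + 9000 * (h * ln (n%:R / 100%:R^-1)) + 768 * (h * ln h) +
  (2 * n%:R + 9000 * (h1 * ln (n%:R / (delta / 2 ^+ k.+1))) + 768 * (h1 * ln h1))
  <= (1000 * 1000) * Q * k.+1%:R.
Proof.
move=> n0 /andP[d0 d1] h10 h20 QE hE.
have n1 : 1 <= n%:R :> R by rewrite ler1n.
have idelta : 100 <= delta^-1 by rewrite -[100]invrK lef_pV2 ?posrE ?invr_gt0 ?ltW.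
set l := ln (n%:R / delta).
have l1 : 1 <= l by apply: ln_ratio_ge1; rewrite ?d0 ?ltW.
have lnn : 0 <= ln n%:R :> R by exact: ln_ge0.
set psi1 := h1 * ln (delta^-1 * (n%:R * h1)) in QE *.
set psi2 := h2 * ln (n%:R * h2) in QE *.
have psi1E : psi1 = h1 * l + h1 * ln h1.
  rewrite /psi1; move: h10; rewrite le_eqVlt => /predU1P[<-|h10].
    by rewrite !mul0r addr0.
  rewrite mulrA [delta^-1 * _]mulrC (@ln_mul (n%:R / delta))// ?mulrDr//.
  by rewrite divr_gt0//; lra.
have psi2E : psi2 = h2 * ln n%:R + h2 * ln h2.
  rewrite /psi2; move: h20; rewrite le_eqVlt => /predU1P[<-|h20].
    by rewrite !mul0r addr0.
  by rewrite ln_mul ?mulrDr//; lra.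
have phi1 := xlnx_ge_half h10; have phi2 := xlnx_ge_half h20.
have phi1' := le_xlnx_add1 h10; have phi2' := le_xlnx_add1 h20.
have psi1_ge : - 100^-1 <= psi1.
  have : h1 <= h1 * l by rewrite ler_peMr.
  have /xlnx_ge_half : 0 <= 100 * h1 by lra.
  move: h10; rewrite le_eqVlt => /predU1P[h1z|h10]; first by rewrite psi1E -h1z; lra.
  rewrite /psi1. 
  (* As [delta^-1 >= 100], [psi1] dominates [h1 * ln (100 * h1)], which is at least [- 1 / 200] by
     [xlnx_ge_half] at [100 * h1]. *)
  have : ln (100 * h1) <= ln (delta^-1 * (n%:R * h1)).
    have nh1 : h1 <= n%:R * h1 by rewrite ler_peMl// ltW.
    have dh1 : 100 * (n%:R * h1) <= delta^-1 * (n%:R * h1).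
      by apply: ler_wpM2r; lra.
    by rewrite ler_ln ?posrE; lra.
  rewrite -(ler_pM2l h10); lra.
have psi2_ge : h2 * ln h2 <= psi2 by have := mulr_ge0 h20 lnn; lra.
have phi1_le : h1 * ln h1 <= psi1.
  by have : 0 <= h1 * l; [apply: mulr_ge0; lra|lra].
have Q1 : 1 <= 4 * Q by rewrite QE; lra.
have h1l : h1 * l <= 3 * Q by rewrite QE in Q1 *; lra.
have psi1Q : psi1 <= Q by rewrite QE; lra.
have psi2Q : psi2 <= Q by rewrite QE; lra.
have nQ : n%:R <= 4 * Q by rewrite QE in Q1 *; lra.
have phih := xlnx_add h10 h20; rewrite -hE in phih.
have h1h1l : h1 <= h1 * l by rewrite ler_peMr.
have l0E : ln (n%:R / 100^-1) = ln n%:R + ln 100 :> R.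
  by rewrite invrK ln_mul//; lra.
have l0l : ln (n%:R / 100^-1) <= l.
  rewrite invrK /l ler_ln ?posrE ?mulr_gt0 ?invr_gt0//; [|lra..].
  by rewrite ler_pM2l//; lra.
(* The part [h1] trades [ln (100 * n)] for [l], using [delta < 1 / 100]; the part [h2] keeps [ln n]
   and is charged no [ln (1 / delta)]. The 7 comes from [100 <= 2 ^ 7]. *)
have hl0 : h * ln (n%:R / 100^-1) <= h1 * l + (h2 * ln n%:R + 7 * h2).
  have : h1 * ln (n%:R / 100^-1) <= h1 * l by rewrite ler_wpM2l.
  have ln100 : ln 100 <= 7 :> R.
    have : ln 100 <= ln (2 ^+ 7) :> R by rewrite ler_ln ?posrE ?exprn_gt0//; lra.
    by rewrite lnXn//; have := ln2_le1; lra.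
  have : h2 * ln 100 <= h2 * 7 by rewrite ler_wpM2l.
  by rewrite l0E hE; lra.
have lk : ln (n%:R / (delta / 2 ^+ k.+1)) <= l + k.+1%:R.
  have -> : n%:R / (delta / 2 ^+ k.+1) = n%:R / delta * 2 ^+ k.+1 :> R.
    by rewrite invf_div mulrAC mulrA.
  rewrite ln_mul ?exprn_gt0//; last by rewrite divr_gt0//; lra.
  have := ler_wpM2r (ler0n R k.+1) ln2_le1; rewrite mul1r mulr_natr lnXn//.
  by rewrite lerD2l.
have K1 : 1 <= k.+1%:R :> R by rewrite ler1n.
have hlk : h1 * ln (n%:R / (delta / 2 ^+ k.+1)) <= h1 * l + h1 * l * k.+1%:R.
  have : h1 * ln (n%:R / (delta / 2 ^+ k.+1)) <= h1 * (l + k.+1%:R).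
    by rewrite ler_wpM2l.
  have : h1 * k.+1%:R <= h1 * l * k.+1%:R by apply: ler_wpM2r; lra.
  by lra.
have QK : Q <= Q * k.+1%:R by rewrite ler_peMr//; lra.
split=> //.
have : h1 * l * k.+1%:R <= 3 * Q * k.+1%:R by apply: ler_wpM2r; lra.
lra.
Qed.

End LogBounds.

(** * Bottleneck values and gaps *)

Section MinW.
Context (R : realType) (n : nat).
Implicit Types (M : {set 'I_n}) (F : {set {set 'I_n}}) (v u : 'I_n -> R).

Lemma minW_le M v e : e \in M -> (minW M v <= (v e)%:E)%E.
Proof. by move=> eM; rewrite /minW (bigD1 e)//= ge_min lexx. Qed.

Lemma le_minW M v (x : \bar R) :
  (forall e, e \in M -> (x <= (v e)%:E)%E) -> (x <= minW M v)%E.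
Proof. by move=> xM; apply: le_bigmin; rewrite ?leey. Qed.

Lemma minW_attained M v : M != finset.set0 ->
  exists2 e, e \in M & minW M v = (v e)%:E.
Proof.
move=> /set0Pn[e0 e0M].
have [e eM emin] := arg_minP v e0M.
exists e => //; apply/le_anti; rewrite minW_le//=.
by apply: le_minW => e' e'M; rewrite lee_fin emin.
Qed.

Lemma minW_le_pointwise M v u :
  (forall e, e \in M -> v e <= u e) -> (minW M v <= minW M u)%E.
Proof.
by move=> vu; apply: le_minW => e eM; rewrite (le_trans (minW_le v eM))// lee_fin vu.
Qed.

Lemma minW_anti M M' v : M \subset M' -> (minW M' v <= minW M v)%E.
Proof. by move=> /fintype.subsetP MM'; apply: le_minW => e /MM' /minW_le. Qed.

Lemma minW_maxW F M v : M \in F -> (minW M v <= maxW F v)%E.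
Proof. by move=> MF; rewrite /maxW (bigD1 M)//= le_max lexx. Qed.

Lemma maxW_lt F v (x : R) :
  (forall M, M \in F -> (minW M v < x%:E)%E) -> (maxW F v < x%:E)%E.
Proof. by move=> Fx; apply: bigmax_lt; rewrite ?ltNyr. Qed.

Lemma arg_min_minW M v (am : {set 'I_n} -> ('I_n -> R) -> 'I_n) :
  arg_min_spec am -> M != finset.set0 -> minW M v = (v (am M v))%:E.
Proof.
move=> hm M0; have [cM cmin] := hm M v M0.
apply/le_anti; rewrite minW_le//=; apply: le_minW => e eM.
by rewrite lee_fin cmin.
Qed.

Section Gap.
Variables (F : {set {set 'I_n}}) (Mstar : {set 'I_n}) (w : 'I_n -> R).
Hypothesis F0 : finset.set0 \notin F.
Hypothesis Mstar_opt : unique_optimum F w Mstar.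

Lemma feasible_neq0 M : M \in F -> M != finset.set0.
Proof. by move=> MF; apply: contraNneq F0 => <-. Qed.

Lemma feasible_minW M v : M \in F -> exists2 x : R, minW M v = x%:E &
  exists2 e, e \in M & v e = x.
Proof.
move=> /feasible_neq0/(minW_attained v)[e eM ->].
by exists (v e) => //; exists e.
Qed.

Lemma subE_maxW_le (G : {set {set 'I_n}}) M (x y c : R) :
  M \in G -> minW M w = y%:E -> x <= y + c ->
  (x%:E - maxW G w <= c%:E)%E.
Proof.
move=> MG My xyc; have := minW_maxW w MG; rewrite My.
by case: maxW => [m| |] //=; rewrite ?leNye// !lee_fin => ym; lra.
Qed.

Lemma gap_opt_le p M (y c : R) : p \in Mstar -> M \in F -> M != Mstar ->
  minW M w = y%:E -> w p <= y + c -> (gap F Mstar w p <= c%:E)%E.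
Proof.
move=> pM MF MMs; rewrite /gap pM; apply: subE_maxW_le.
by rewrite in_setD1 MMs.
Qed.

Lemma gap_nonopt_le p M (opt y c : R) : p \notin Mstar -> M \in F -> p \in M ->
  minW Mstar w = opt%:E -> minW M w = y%:E ->
  (opt <= w p -> w p <= y + c) -> (w p < opt -> opt <= y + c) ->
  (gap F Mstar w p <= c%:E)%E.
Proof.
move=> pMs MF pM oE yE h1 h2; rewrite /gap (negbTE pMs) oE lee_fin.
by case: (lerP opt (w p)) => h; apply: (subE_maxW_le _ yE); rewrite ?inE ?MF ?pM ?h1 ?h2 //.
Qed.

(** Uniqueness of the optimum makes the competing maximum strictly smaller; without competitors that
    maximum is [-oo] and the gap is [+oo]. *)
Lemma gap_gt0 p : (0 < gap F Mstar w p)%E.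
Proof.
have [MsF opt_lt] := Mstar_opt.
have [ob oE _] := feasible_minW w MsF.
have sub_gt0 (x : R) (m : \bar R) : (m < x%:E)%E -> (0 < x%:E - m)%E.
  by move=> mx; rewrite sube_gt0.
rewrite /gap oE; have [pM|pM] := ifPn.
  apply: sub_gt0; apply: maxW_lt => M; rewrite in_setD1 => /andP[MMs MF].
  by apply: lt_le_trans (minW_le w pM); exact: opt_lt.
have lt_o : (maxW [set M in F | p \in M]%SET w < ob%:E)%E.
  apply: maxW_lt => M; rewrite inE => /andP[MF Mp].
  by rewrite -oE; apply: opt_lt => //; apply: contraTneq Mp => ->.
rewrite lee_fin; case: lerP => [op|_]; apply: sub_gt0 => //.
by apply: lt_le_trans lt_o _; rewrite lee_fin.
Qed.

End Gap.
End MinW.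

(** * One round of exploration or verification *)

Section Rounds.
Context (R : realType) (n : nat).
Variables (F : {set {set 'I_n}}) (Mstar : {set 'I_n}) (w : 'I_n -> R).
Variable sub : subroutines R n.
Hypothesis F0 : finset.set0 \notin F.
Hypothesis Mstar_opt : unique_optimum F w Mstar.
Hypothesis sub_ok : subroutines_spec sub.

Let MsF : Mstar \in F. Proof. by case: Mstar_opt. Qed.

Let F_neq0 : F != finset.set0. Proof. by apply/set0Pn; exists Mstar. Qed.

Lemma max_oracleF v : max_oracle sub F v \in F.
Proof. by case: sub_ok => /(_ F v F_neq0)[]. Qed.

Lemma opt_eq M : M \in F -> (minW Mstar w <= minW M w)%E -> M = Mstar.
Proof.
move=> MF; apply: contraTeq => MMs; rewrite -ltNge.
by case: Mstar_opt => _; exact.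
Qed.

Section Confident.
Variables lo up r : 'I_n -> R.
Hypothesis up_lo : forall e, up e = lo e + 2 * r e.
Hypothesis conf : forall e, lo e <= w e <= up e.

Let lo_w e : lo e <= w e. Proof. by case/andP: (conf e). Qed.
Let w_up e : w e <= up e. Proof. by case/andP: (conf e). Qed.

Let minW_lo M y : M \in F -> (y%:E <= minW M lo)%E ->
  exists2 z, minW M w = z%:E & y <= z.
Proof.
move=> MF yM; have [z zE _] := feasible_minW F0 w MF; exists z => //.
rewrite -lee_fin -zE (le_trans yM)//; exact: minW_le_pointwise.
Qed.

Section Explore.
Let M := max_oracle sub F lo.
Let B := bottleneck_search sub F M lo.
Let c := Defs.arg_min sub M lo.
Let threshold e := (2^-1%:E * (minW M lo + (lo e)%:E))%E.

Let MF : M \in F. Proof. exact: max_oracleF. Qed.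

Let cM : c \in M.
Proof. by case: sub_ok => _ _ /(_ M lo (feasible_neq0 F0 MF))[]. Qed.

Let minWM : minW M lo = (lo c)%:E.
Proof. by apply: arg_min_minW (feasible_neq0 F0 MF); case: sub_ok. Qed.

Let thresholdE e : threshold e = (2^-1 * (lo c + lo e))%:E.
Proof. by rewrite /threshold minWM -EFinD -EFinM. Qed.

Let M_max M' : M' \in F -> (minW M' lo <= (lo c)%:E)%E.
Proof.
move=> M'F; rewrite -minWM; have [/(_ F lo F_neq0)[_ h] _ _ _] := sub_ok.
exact: h.
Qed.

Let hit M' : M' \in F -> ~~ (M \subset M') ->
  exists e, [/\ e \in B, e \in M' & (lo e)%:E = minW M' lo].
Proof.
move=> M'F MM'; case: sub_ok => _ /(_ F M lo F0)[+ _] _ _.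
by apply; rewrite !inE MM' M'F.
Qed.

Let from e : e \in B ->
  exists M', [/\ M' \in F, ~~ (M \subset M'), e \in M' & (lo e)%:E = minW M' lo].
Proof.
case: sub_ok => _ /(_ F M lo F0)[_ +] _ _ => /(_ e) h /h[M' [+ eM' eE]].
by rewrite !inE => /andP[MM' M'F]; exists M'.
Qed.

Let lo_le e : e \in B -> lo e <= lo c.
Proof. by move=> /from[M' [M'F _ _ eE]]; rewrite -lee_fin eE M_max. Qed.

Let proper_opt : M \subset Mstar -> M = Mstar.
Proof. by move=> /minW_anti MMs; apply: opt_eq. Qed.

Let opt_le_up e : e \in Mstar -> (minW Mstar w <= (up e)%:E)%E.
Proof.
by move=> eMs; rewrite (le_trans (minW_le w eMs))// lee_fin.
Qed.

(** If [M] is contained in [Mstar], its value is at least the optimum. Otherwise the bottleneck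
    search has put an arm [e] of [Mstar] into [B], and the stopping test gives
    [OPT <= w e <= up e <= lo c <= minW M w]. Uniqueness concludes. *)
Lemma explore_return_opt :
  [forall e in B, ((up e)%:E <= threshold e)%E] -> M = Mstar.
Proof.
move=> /'forall_implyP small; apply/eqP; rewrite -(negbK (_ == _)); apply/negP => MMs.
have [MsubMs|MsubMs] := boolP (M \subset Mstar).
  by rewrite proper_opt ?eqxx in MMs.
have [e [eB eMs eE]] := hit MsF MsubMs.
have := small e eB; rewrite thresholdE lee_fin => ue.
have le := lo_le eB.
have [z zE cz] : exists2 z, minW M w = z%:E & lo c <= z.
  by apply: minW_lo MF _; rewrite minWM.
move/negP: MMs; apply; apply/eqP/opt_eq => //.
by rewrite (le_trans (opt_le_up eMs))// zE lee_fin; lra.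
Qed.

(** What exploration hands over to verification. The factor [1 / 2] of the stopping test places the
    true mean of each arm of [B] at most halfway between a suboptimal value and the optimum, so that
    separating the two later costs only a constant factor. *)
Lemma explore_return_bottleneck :
  [forall e in B, ((up e)%:E <= threshold e)%E] ->
  [/\ forall M', M' \in F -> ~~ (Mstar \subset M') ->
        exists2 e, e \in M' /\ e \in B &
        ((w e)%:E <= 2^-1%:E * (minW Mstar w + minW M' w))%E &
      forall e, e \in B -> exists M', [/\ M' \in F, ~~ (Mstar \subset M'),
        e \in M' & ((w e)%:E <= 2^-1%:E * (minW Mstar w + minW M' w))%E]].
Proof.
move=> small; have MMs := explore_return_opt small.
move/'forall_implyP : small => small.
have key M' e : M' \in F -> e \in B -> (lo e)%:E = minW M' lo ->
    ((w e)%:E <= 2^-1%:E * (minW Mstar w + minW M' w))%E.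
  move=> M'F eB eE; have := small e eB; rewrite thresholdE lee_fin => ue.
  have [z zE ez] : exists2 z, minW M' w = z%:E & lo e <= z.
    by apply: minW_lo M'F _; rewrite eE.
  have [z' zE' cz'] : exists2 z, minW Mstar w = z%:E & lo c <= z.
    by apply: minW_lo MsF _; rewrite -MMs minWM.
  rewrite zE zE' -EFinD -EFinM lee_fin.
  by have := w_up e; lra.
split=> [M' M'F MM'|e eB].
  rewrite -MMs in MM'; have [e [eB eM' eE]] := hit M'F MM'.
  by exists e => //; exact: key.
have [M' [M'F MM' eM' eE]] := from eB.
by exists M'; rewrite -MMs; split => //; rewrite MMs; exact: key.
Qed.

(** The played arm has the largest radius among the candidates, so all their intervals have width at
    most [2 * r p]. Each case then exhibits one super arm that bounds the gap: [M] itself, or a set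
    [M'] whose bottleneck is an arm of [B']. Exploration alone would allow 6; the 8 is dictated by
    verification. *)
Lemma explore_play_gap :
  ~~ [forall e in B, ((up e)%:E <= threshold e)%E] ->
  forall p,
  p = Defs.arg_max sub (c |: [set e in B | (threshold e < (up e)%:E)%E]) r ->
  (gap F Mstar w p <= (8 * r p)%:E)%E.
Proof.
move=> big p; set B' := [set e in B | _]%SET => pE.
have cB'0 : c |: B' != finset.set0 by apply/set0Pn; exists c; rewrite !inE eqxx.
have [pB' pmax] : p \in c |: B' /\ forall e, e \in c |: B' -> r e <= r p.
  by rewrite pE; case: sub_ok => _ _ _ /(_ _ r cB'0).
have rc : r c <= r p by apply: pmax; rewrite !inE eqxx.
have rB' e : e \in B' -> r e <= r p by move=> eB'; apply: pmax; rewrite inE eB' orbT.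
have B'B e : e \in B' -> e \in B by rewrite inE => /andP[].
(* Violating the test means [lo e + 2 * r e > (lo c + lo e) / 2], that is
   [lo e > lo c - 4 * r e]. *)
have B'lo e : e \in B' -> lo c - 4 * r p <= lo e.
  move=> eB'; have := rB' e eB'; move: eB'; rewrite inE thresholdE lte_fin up_lo.
  by move=> /andP[_]; lra.
have notB' e : e \in B -> e \notin B' -> up e <= lo c.
  move=> eB; have := lo_le eB; rewrite inE eB/= thresholdE lte_fin -leNgt; lra.
have [e1 e1B'] : exists e, e \in B'.
  move: big; rewrite negb_forall => /existsP[e]; rewrite negb_imply => /andP[eB].
  by rewrite -ltNge => eup; exists e; rewrite inE eB.
have rp0 : 0 <= r p by have := lo_w p; have := w_up p; rewrite up_lo; lra.
have [ob obE _] := feasible_minW F0 w MsF.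
have ob_le e : e \in Mstar -> ob <= w e.
  by move=> eMs; rewrite -lee_fin -obE minW_le.
have [wM wME cwM] : exists2 z, minW M w = z%:E & lo c <= z.
  by apply: minW_lo MF _; rewrite minWM.
have w_lo e : w e <= lo e + 2 * r e by rewrite -up_lo.
have wc := w_lo c; have wp := w_lo p.
have bottleneck e M' : M' \in F -> (lo e)%:E = minW M' lo ->
    exists2 z, minW M' w = z%:E & lo e <= z.
  by move=> M'F eE; apply: minW_lo M'F _; rewrite eE.
(* Either [c] lies in [Mstar], or [Mstar] has a bottleneck [e] in [B]: inside [B'] its radius is at
   most [r p], outside [B'] its upper bound is at most [lo c]. *)
have opt_bound : p \notin Mstar -> w p < ob -> ob <= lo c + 2 * r p.
  move=> pMs wpo; have [MMs|MMs] := boolP (M \subset Mstar).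
    by have := ob_le c (fintype.subsetP MMs c cM); lra.
  have [e [eB eMs eE]] := hit MsF MMs; have oe := ob_le e eMs.
  have [eB'|eB'] := boolP (e \in B').
    by have := rB' e eB'; have := w_lo e; have := lo_le eB; lra.
  have := notB' e eB eB'; have := w_up e.
  move: pB'; rewrite in_setU1 => /orP[/eqP pc|pB']; last first.
    by have := lo_le (B'B _ pB'); lra.
  by have := lo_w c; rewrite -pc; lra.
have [pMs|pMs] := boolP (p \in Mstar).
  move: pB'; rewrite in_setU1 => /orP[/eqP pc|pB'].
    have [MMs|MMs] := eqVneq M Mstar; last first.
      by apply: (gap_opt_le pMs MF MMs wME); rewrite pc in wp rp0 *; lra.
    (* With [M = Mstar] a different super arm must witness the gap; the arm [e1], present because
       the stopping test failed, provides one. *)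
    have [M' [M'F MM' _ eE]] := from (B'B e1 e1B').
    have [z zE ez] := bottleneck _ _ M'F eE.
    apply: (gap_opt_le pMs M'F _ zE); first by apply: contraNneq MM' => ->; rewrite MMs.
    by have := B'lo e1 e1B'; rewrite pc in wp rp0 *; lra.
  have [M' [M'F MM' pM' eE]] := from (B'B p pB').
  have [z zE ez] := bottleneck _ _ M'F eE.
  have [M'Ms|M'Ms] := eqVneq M' Mstar; last first.
    by apply: (gap_opt_le pMs M'F M'Ms zE); lra.
  apply: (gap_opt_le pMs MF _ wME).
    by apply: contraNneq MM' => ->; rewrite M'Ms.
  by have := lo_le (B'B p pB'); lra.
have {}opt_bound := opt_bound pMs.
move: pB'; rewrite in_setU1 => /orP[/eqP pc|pB'].
  apply: (gap_nonopt_le pMs MF _ obE wME); rewrite ?pc//.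
    by rewrite pc in wp rp0; lra.
  by rewrite -pc => /opt_bound; lra.
have [M' [M'F MM' pM' eE]] := from (B'B p pB').
have [z zE ez] := bottleneck _ _ M'F eE.
apply: (gap_nonopt_le pMs M'F pM' obE zE); first by lra.
by move=> /opt_bound; have := B'lo p pB'; lra.
Qed.

End Explore.

Section Verify.
Variable B : {set 'I_n}.
Let G := F :\: supersets Mstar.
Let Mt := max_oracle sub G up.
Let c := Defs.arg_min sub Mstar lo.
Hypothesis B_hit : forall M', M' \in F -> ~~ (Mstar \subset M') ->
  exists2 e, e \in M' /\ e \in B &
  ((w e)%:E <= 2^-1%:E * (minW Mstar w + minW M' w))%E.
Hypothesis B_from : forall e, e \in B ->
  exists M', [/\ M' \in F, ~~ (Mstar \subset M'), e \in M' &
    ((w e)%:E <= 2^-1%:E * (minW Mstar w + minW M' w))%E].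

(** The origin of the 8. For [p = c], the challenger [Mt] contains an arm [e] of [B] with
    [lo c < up e], so [w c <= w e + 4 * r p]. As [w e] is at most the midpoint of [OPT] and the
    value of [Mt], and [OPT <= w c], solving for [w c] doubles the 4. For [p] in [B], lying below a
    midpoint excludes both [Mstar] and [setNt]. *)
Lemma verify_play_gap :
  ~~ ((G == finset.set0) || (minW Mt up <= minW Mstar lo)%E) ->
  forall p, p = Defs.arg_max sub (c |: [set e in B | lo c < up e]%SET) r ->
  p \in Mstar :|: setN Mstar w /\ (gap F Mstar w p <= (8 * r p)%:E)%E.
Proof.
rewrite negb_or -ltNge => /andP[G0 ltup] p; set Ft := [set e in B | _]%SET => pE.
have cFt0 : c |: Ft != finset.set0 by apply/set0Pn; exists c; rewrite !inE eqxx.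
have [pFt pmax] : p \in c |: Ft /\  forall e, e \in c |: Ft -> r e <= r p.
  by rewrite pE; case: sub_ok => _ _ _ /(_ _ r cFt0).
have rc : r c <= r p by apply: pmax; rewrite !inE eqxx.
have w_lo e : w e <= lo e + 2 * r e by rewrite -up_lo.
have cMs : c \in Mstar.
  by have [_ _ /(_ Mstar lo (feasible_neq0 F0 MsF))[]] := sub_ok.
have [ob obE _] := feasible_minW F0 w MsF.
have ob_le e : e \in Mstar -> ob <= w e.
  by move=> eMs; rewrite -lee_fin -obE minW_le.
have minWMs : minW Mstar lo = (lo c)%:E.
  have [_ _ am _] := sub_ok; exact: (arg_min_minW _ am (feasible_neq0 F0 MsF)).
have obc := ob_le c cMs; have wc := w_lo c.
have [MtF MsMt] : Mt \in F /\ ~~ (Mstar \subset Mt).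
  have : Mt \in G by case: sub_ok => /(_ G up G0)[].
  by rewrite !inE => /andP[].
move: pFt; rewrite in_setU1 => /orP[/eqP pc|pFt].
  rewrite inE pc cMs; split=> //.
  have [e [eMt eB] he] := B_hit MtF MsMt.
  have [z zE _] := feasible_minW F0 w MtF.
  have eup : lo c < up e.
    rewrite -lte_fin -minWMs (lt_le_trans ltup)//; exact: minW_le.
  have re : r e <= r p by apply: pmax; rewrite !inE eB eup orbT.
  apply: (gap_opt_le cMs MtF _ zE).
    by apply: contraNneq MsMt => ->.
  move: he; rewrite obE zE -EFinD -EFinM lee_fin.
  have := w_lo c; have := lo_w e; move: eup; rewrite up_lo pc in re *; lra.
have /andP[pB pup] : (p \in B) && (lo c < up p) by move: pFt; rewrite inE.
have [M' [M'F MM' pM']] := B_from pB.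
have [z zE _] := feasible_minW F0 w M'F.
have zo : z < ob.
  rewrite -lte_fin -zE -obE; case: Mstar_opt => _; apply=> //.
  by apply: contraNneq MM' => ->.
rewrite obE zE -EFinD -EFinM lee_fin => hp.
have pMs : p \notin Mstar by apply/negP => /ob_le; lra.
have wpo : w p < ob by lra.
split; first by rewrite !inE (negbTE pMs)/= obE lte_fin.
apply: (gap_nonopt_le pMs M'F pM' obE zE); first by lra.
by move=> _; have := lo_w p; move: pup; rewrite up_lo; lra.
Qed.

End Verify.

(** Unless [Mhat] is inside [Mstar], the optimum competes in [G], and [OPT <= minW Mt up <= minW
    Mhat lo <= minW Mhat w]. A wrong exploration output can thus delay a copy, but cannot corrupt
    its answer while the verification intervals hold. *)
Lemma verify_return_opt Mhat : Mhat \in F ->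
  let G := F :\: supersets Mhat in
  (G == finset.set0) || (minW (max_oracle sub G up) up <= minW Mhat lo)%E ->
  Mhat = Mstar.
Proof.
move=> MF G ret; have [sMs|sMs] := boolP (Mhat \subset Mstar).
  by apply: opt_eq => //; exact: minW_anti.
have MsG : Mstar \in G by rewrite !inE sMs MsF.
have G0 : G != finset.set0 by apply/set0Pn; exists Mstar.
move: ret; rewrite (negbTE G0)/= => ret.
have Mt_max : (minW Mstar up <= minW (max_oracle sub G up) up)%E.
  by have [/(_ G up G0)[_ h] _ _ _] := sub_ok; exact: h.
apply: opt_eq => //; apply: le_trans (minW_le_pointwise (fun e _ => w_up e)) _.
exact: le_trans Mt_max (le_trans ret (minW_le_pointwise (fun e _ => lo_w e))).
Qed.

End Confident.
End Rounds.

(** * Length of a well-estimated history *)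

Section Plays.
Context (R : realType) (n : nat) (A : Type).
Variable alg : history R n -> action n A.
Implicit Types (h g : history R n) (e : 'I_n).

(** Only the choice of arms is constrained; the rewards are arbitrary, so the counting below is
    deterministic. *)
Inductive plays : history R n -> Prop :=
| plays_nil : plays [::]
| plays_rcons h p : plays h -> alg h = Play p.1 -> plays (rcons h p).

Definition initializes : Prop :=
  forall h, (size h < n)%N -> exists2 e, alg h = Play e & val e = size h.

Lemma plays_rconsP h p : plays (rcons h p) -> plays h /\ alg h = Play p.1.
Proof.
move E : (rcons h p) => g H; case: H E => [|g' q pg' ag']; first by case: h.
by move=> /rcons_inj[-> ->].
Qed.

Lemma plays_prefix g g' : plays (g ++ g') -> plays g.
Proof.
elim/last_ind: g' => [|g' p IH]; first by rewrite cats0.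
by rewrite -rcons_cat => /plays_rconsP[/IH].
Qed.

Lemma nb_plays_rcons h p e :
  nb_plays (rcons h p) e = (nb_plays h e + (p.1 == e))%N.
Proof. by rewrite /nb_plays -cats1 count_cat /= addn0. Qed.

Lemma size_sum_nb_plays h : size h = (\sum_(e : 'I_n) nb_plays h e)%N.
Proof.
elim/last_ind: h => [|h p IH]; first by rewrite big1.
under eq_bigr do rewrite nb_plays_rcons.
rewrite big_split/= -IH size_rcons (bigD1 p.1)//= eqxx big1 ?addn0 ?addn1//.
by move=> e; rewrite eq_sym => /negbTE ->.
Qed.

Hypothesis init : initializes.

Lemma nb_plays_init h e : plays h -> (size h <= n)%N ->
  nb_plays h e = (e < size h)%N.
Proof.
elim/last_ind: h => [|h p IH]; first by [].
move=> /plays_rconsP[ph ap]; rewrite size_rcons => hn.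
rewrite nb_plays_rcons IH//; last exact: ltnW.
have [e' ae' e'E] := init hn; move: ap; rewrite ae' => -[<-].
rewrite ltnS -(inj_eq val_inj e' e) e'E /=.
by case: (ltngtP e (size h)).
Qed.

Lemma nb_plays_gt0 h e : plays h -> (n <= size h)%N -> (0 < nb_plays h e)%N.
Proof.
elim/last_ind: h => [|h p IH] ph.
  by rewrite leqn0 => /eqP n0; case: e => e; rewrite n0.
rewrite leq_eqVlt => /predU1P[nE|].
  by rewrite nb_plays_init -?nE// ltn_ord.
rewrite size_rcons ltnS nb_plays_rcons => nh.
by have [{}ph _] := plays_rconsP ph; rewrite ltn_addr// IH.
Qed.

(** The last play of [e] is either its initialization or subject to the bound [c e] just before it;
    it adds 1. *)
Lemma nb_plays_bound (c : 'I_n -> R) h e : (forall e, 0 <= c e) ->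
  plays h ->
  (forall g g' p, h = g ++ g' -> plays g -> (n <= size g < size h)%N ->
    alg g = Play p -> (nb_plays g p)%:R <= c p) ->
  (nb_plays h e)%:R <= 1 + c e.
Proof.
move=> c0; elim/last_ind: h => [|h p IH] ph hc.
  by rewrite /nb_plays/= addr_ge0.
have [hn|nh] := leqP n (size h); last first.
  rewrite nb_plays_init ?size_rcons//.
  by apply: (@le_trans _ _ 1); rewrite ?lerDl// lern1 leq_b1.
have {}ph := plays_rconsP ph; have [ph1 ap] := ph.
have : (nb_plays h e)%:R <= 1 + c e.
  apply: IH => // g g' q hE pg /andP[ng gh]; apply: (hc g (rcons g' p)) => //.
    by rewrite hE rcons_cat.
  by rewrite ng size_rcons ltnW.
rewrite nb_plays_rcons; case: eqP => [<- _|_]; last by rewrite addn0.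
rewrite natrD addrC lerD2l; apply: (hc h [:: p]) => //.
  by rewrite cats1.
by rewrite hn size_rcons ltnSn.
Qed.

End Plays.

Section Length.
Context (R : realType) (n : nat).
Implicit Types eta : R.
Variables (F : {set {set 'I_n}}) (Mstar : {set 'I_n}) (w : 'I_n -> R) (sg : R).
Hypothesis F0 : finset.set0 \notin F.
Hypothesis Mstar_opt : unique_optimum F w Mstar.

Definition cost (e : 'I_n) : R :=
  fine ((sg ^+ 2)%:E / (gap F Mstar w e ^+ 2))%E.

Lemma costE e : ((sg ^+ 2)%:E / (gap F Mstar w e ^+ 2))%E = (cost e)%:E.
Proof.
rewrite /cost; have := gap_gt0 F0 Mstar_opt e.
case: gap => [x||//]; last by rewrite expe2 mulyy invey mule0.
rewrite lte_fin => x0.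
by rewrite -EFin_expe inver gt_eqF ?exprn_gt0// -EFinM.
Qed.

Lemma cost_ge0 e : 0 <= cost e.
Proof.
rewrite -lee_fin -costE mule_ge0// ?lee_fin ?sqr_ge0// inve_ge0 expe_ge0//.
exact/ltW/gap_gt0.
Qed.

Lemma hardnessE (A : {set 'I_n}) :
  hardness F Mstar w sg A = (\sum_(e in A) cost e)%:E.
Proof. by rewrite /hardness -sumEFin; apply: eq_bigr => e _; rewrite costE. Qed.

(** Squaring [gap <= 8 * sg * sqrt (2 * l / N)] and solving for [N] gives [128 = 2 * 8 ^ 2]. *)
Lemma nb_plays_cost eta (h : history R n) e :
  let l := ln (4 * n%:R * (size h).+1%:R ^+ 3 / eta) in
  0 <= l -> (0 < nb_plays h e)%N ->
  (gap F Mstar w e <= (8 * Defs.rad sg eta h e)%:E)%E ->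
  (nb_plays h e)%:R <= 128 * cost e * l.
Proof.
move=> l l0; rewrite /Defs.rad -/l; move: (nb_plays h e) => N N0 le_gap.
have NR : 0 < N%:R :> R by rewrite ltr0n.
have := costE e; have := gap_gt0 F0 Mstar_opt e; move: le_gap.
case: gap => [x| |]//; rewrite lee_fin lte_fin => xr x0.
rewrite -EFin_expe inver gt_eqF ?exprn_gt0// -EFinM => -[<-].
have : x ^+ 2 <= (8 * (sg * Num.sqrt (2 * l / N%:R))) ^+ 2.
  by rewrite ler_sqr// nnegrE ltW// (lt_le_trans x0).
rewrite !exprMn sqr_sqrtr; last by rewrite divr_ge0 ?mulr_ge0// ltW.
have x2 : 0 < x ^+ 2 by rewrite exprn_gt0.
move=> le1; rewrite -(ler_pM2r x2).
have -> : 128 * (sg ^+ 2 / x ^+ 2) * l * x ^+ 2 = 128 * sg ^+ 2 * l by field; lra.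
have : N%:R * x ^+ 2 <= N%:R * (8 ^+ 2 * (sg ^+ 2 * (2 * l / N%:R))).
  by rewrite ler_pM2l.
have -> : N%:R * (8 ^+ 2 * (sg ^+ 2 * (2 * l / N%:R))) = 128 * sg ^+ 2 * l.
  by field; lra.
by [].
Qed.

(** All prefixes matter, since each past decision relied on its own intervals. Those shorter than
    [n] are left out: an arm not yet played has a junk mean and radius 0. *)
Definition well_estimated (eta : R) (h : history R n) : Prop :=
  forall g g', h = g ++ g' -> (n <= size g)%N ->
  forall e, `|emp_mean g e - w e| <= Defs.rad sg eta g e.

Lemma well_estimated_bounds eta h e : well_estimated eta h -> (n <= size h)%N ->
  lcb sg eta h e <= w e <= ucb sg eta h e.
Proof.
move=> we nh; have := we h [::]; rewrite cats0 => /(_ erefl nh e).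
by rewrite ler_distlC /lcb /ucb => /andP[h1 h2]; apply/andP; split; lra.
Qed.

Lemma well_estimated_prefix eta g g' :
  well_estimated eta (g ++ g') -> well_estimated eta g.
Proof. by move=> we g1 g2 gE; apply: (we g1 (g2 ++ g')); rewrite gE catA. Qed.

(** Summing the play counts over the arms bounds the length by an expression with the length inside
    a logarithm, which [log_recursion] resolves. [S] is the full set for exploration and
    [Mstar :|: setN] for verification. *)
Lemma plays_length A (alg : history R n -> action n A) eta (S : {set 'I_n}) h H :
  H = \sum_(e in S) cost e ->
  initializes alg -> 0 < eta <= 100%:R^-1 -> plays alg h ->
  well_estimated eta h ->
  (forall g p, plays alg g -> (n <= size g)%N -> well_estimated eta g ->
     alg g = Play p ->
     p \in S /\ (gap F Mstar w p <= (8 * Defs.rad sg eta g p)%:E)%E) ->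
  (size h)%:R <= 2 * n%:R + 9000 * (H * ln (n%:R / eta)) + 768 * (H * ln H).
Proof.
move=> HE init eta1 ph we hplay.
have H0 : 0 <= H by rewrite HE; apply: sumr_ge0 => e _; exact: cost_ge0.
have n0 : (0 < n)%N.
  have [MsF _] := Mstar_opt; have /set0Pn[e _] := feasible_neq0 F0 MsF.
  exact: leq_ltn_trans (ltn_ord e).
have n1 : 1 <= n%:R :> R by rewrite ler1n.
have := eta1 => /andP[e0 e1].
case: (posnP (size h)) => [->|h0].
  exact: le_trans (log_bound_ge1 n0 eta1 H0).
set L := ln (4 * n%:R * (size h)%:R ^+ 3 / eta).
have L0 : 0 <= L by exact: log_arg_ge0.
apply: log_recursion => //; rewrite -/L.
have bnd e : (nb_plays h e)%:R <= 1 + (if e \in S then 128 * cost e * L else 0).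
  apply: (@nb_plays_bound _ _ _ alg init
    (fun e => if e \in S then 128 * cost e * L else 0)) => //.
    by move=> e'; case: ifP => // _; rewrite !mulr_ge0// cost_ge0.
  move=> g g' p hE pg /andP[ng gh] ap.
  have weg : well_estimated eta g by apply: (@well_estimated_prefix _ g g'); rewrite -hE.
  have [pS gp] := hplay g p pg ng weg ap.
  rewrite pS; apply: le_trans (nb_plays_cost _ (nb_plays_gt0 init p pg ng) gp) _.
    exact: log_arg_ge0.
  rewrite ler_wpM2l ?mulr_ge0 ?cost_ge0//.
  (* [g] is a proper prefix of [h], so the round number [(size g).+1] in its radius is at most
     [size h]. *)
  rewrite /L ler_ln ?posrE ?divr_gt0 ?mulr_gt0 ?exprn_gt0 ?ltr0n//.
  rewrite ler_pM2r ?invr_gt0// ler_pM2l; last lra.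
  by rewrite lerXn2r ?nnegrE ?ler0n// ler_nat.
rewrite {1}(size_sum_nb_plays h) natr_sum.
apply: le_trans (ler_sum _ (fun e _ => bnd e)) _.
rewrite big_split/= sumr_const card_ord -big_mkcond/= lerD2l -mulr_suml -mulr_sumr.
by rewrite HE lexx.
Qed.

End Length.

(** * Exponential supermartingales *)

Lemma iota_rcons m k : iota m k.+1 = rcons (iota m k) (m + k)%N.
Proof. by rewrite -addn1 iotaD cats1. Qed.

Lemma integral_cst_probability d (T : measurableType d) (R : realType)
  (P : probability T R) (c : R) : (\int[P]_x c%:E = c%:E)%E.
Proof.
rewrite integral_cst//; transitivity (c%:E * P setT)%E; first by [].
by rewrite probability_setT mule1.
Qed.

Section Supermartingales.
Context (R : realType) (n : nat).
Implicit Types (h g : history R n) (e a : 'I_n) (f : history R n -> R).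

(* A symbolic history records, with each play, the timestep whose reward was
   observed instead of the reward itself. *)
Definition realize (hs : seq ('I_n * nat)) (x : nat -> 'I_n -> R) :
    history R n :=
  [seq (p.1, x p.2 p.1) | p <- hs].

(** Stands in for a sigma-algebra on histories: with arms and timesteps fixed, [f] is measurable in
    the rewards, over whichever space carries them. That space will be the sample space, the line,
    or the past paired with a new reward. *)
Definition history_measurable f : Prop :=
  forall d (T : measurableType d) (Y : nat -> 'I_n -> T -> R) hs,
    {in hs, forall p, measurable_fun setT (Y p.2 p.1)} ->
    measurable_fun setT (fun t => f (realize hs (fun i e => Y i e t))).

(** The old rewards enter as constants at the timesteps below [size h], the new one as the identity
    at timestep [size h]. *)
Lemma measurable_history_rcons f h a : history_measurable f ->
  measurable_fun setT (fun x : R => f (rcons h (a, x))).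
Proof.
pose hs := [seq ((nth (a, 0) h i).1, i) | i <- iota 0 (size h).+1].
pose Y i (e : 'I_n) (x : R) := if i == size h then x else (nth (a, 0) h i).2.
move=> /(_ _ _ Y hs); rewrite (_ : (fun t => f _) = fun x => f (rcons h (a, x))).
  by apply=> p _; rewrite /Y; case: eqP.
apply/funext => x; congr f; rewrite /realize /hs -map_comp iota_rcons map_rcons /=.
rewrite /Y eqxx nth_default//=; congr rcons.
rewrite -[RHS](mkseq_nth (a, 0)) /mkseq; apply/eq_in_map => i.
rewrite mem_iota add0n => /= /ltn_eqF ->.
by case: nth.
Qed.

Variable nu : 'I_n -> probability R R.

(** The next arm [a] is arbitrary, so the property survives every adaptive sampling rule. *)
Definition supermartingale f : Prop :=
  [/\ forall h, 0 <= f h, history_measurable f &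
      forall h a, (\int[nu a]_x (f (rcons h (a, x)))%:E <= (f h)%:E)%E].

Lemma supermartingale0 : supermartingale (fun=> 0).
Proof. by split=> // h a; rewrite integral0. Qed.

Lemma supermartingaleD f1 f2 : supermartingale f1 -> supermartingale f2 ->
  supermartingale (fun h => f1 h + f2 h).
Proof.
move=> [p1 m1 s1] [p2 m2 s2]; split=> [h|d T Y hs mY|h a].
- by rewrite addr_ge0.
- exact: (measurable_funD (m1 _ _ _ _ mY) (m2 _ _ _ _ mY)).
under eq_integral do rewrite EFinD.
rewrite ge0_integralD//; first exact: (leeD (s1 h a) (s2 h a)).
- by move=> x _; rewrite lee_fin.
- by apply/measurable_EFinP; exact: measurable_history_rcons.
- by move=> x _; rewrite lee_fin.
- by apply/measurable_EFinP; exact: measurable_history_rcons.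
Qed.

Lemma supermartingaleZ c f : 0 <= c -> supermartingale f ->
  supermartingale (fun h => c * f h).
Proof.
move=> c0 [p m s]; split=> [h|d T Y hs mY|h a].
- by rewrite mulr_ge0.
- exact: (measurable_funM (measurable_cst _) (m _ _ _ _ mY)).
under eq_integral do rewrite EFinM.
rewrite ge0_integralZl_EFin//; first last.
- by apply/measurable_EFinP; exact: measurable_history_rcons.
- by move=> x _; rewrite lee_fin.
by rewrite EFinM; apply: lee_wpmul2l; [rewrite lee_fin|exact: s].
Qed.

Lemma supermartingale_sum (I : Type) (s : seq I) (F : I -> history R n -> R) :
  (forall i, supermartingale (F i)) ->
  supermartingale (fun h => \sum_(i <- s) F i h).
Proof.
move=> sF; elim: s => [|i s IH].
  rewrite (_ : (fun h => _) = fun=> 0); first exact: supermartingale0.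
  by apply/funext => h; rewrite big_nil.
rewrite (_ : (fun h => _) = fun h => F i h + \sum_(j <- s) F j h).
  exact: supermartingaleD.
by apply/funext => h; rewrite big_cons.
Qed.

Variables (w : 'I_n -> R) (sg : R).
Hypothesis subG : forall e, sub_gaussian (nu e) (w e) sg.

Definition arm_rewards h e : seq R := [seq p.2 | p <- h & p.1 == e].

Lemma size_arm_rewards h e : size (arm_rewards h e) = nb_plays h e.
Proof. by rewrite size_map size_filter. Qed.

(** Chernoff exponential of arm [e], stopped at its [k]-th sample by [take]. *)
Definition exp_mart (lam : R) e k h : R :=
  \prod_(x <- take k (arm_rewards h e))
    expR (lam * (x - w e) - lam ^+ 2 * sg ^+ 2 / 2).

Lemma exp_mart_ge0 lam e k h : 0 <= exp_mart lam e k h.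
Proof. by apply: prodr_ge0 => x _; exact: expR_ge0. Qed.

Lemma arm_rewards_rcons h a x e : arm_rewards (rcons h (a, x)) e =
  if a == e then rcons (arm_rewards h e) x else arm_rewards h e.
Proof. by rewrite /arm_rewards filter_rcons /=; case: ifP; rewrite ?map_rcons. Qed.

Lemma exp_mart_supermartingale lam e k : supermartingale (exp_mart lam e k).
Proof.
split=> [h|d T Y hs mY|h a].
- exact: exp_mart_ge0.
- rewrite (_ : (fun t => _) = fun t => \prod_(p <- take k [seq p <- hs | p.1 == e])
      expR (lam * (Y p.2 p.1 t - w e) - lam ^+ 2 * sg ^+ 2 / 2)); last first.
    apply/funext => t; rewrite /exp_mart /arm_rewards /realize filter_map -map_comp.
    by rewrite -map_take big_map.
  have : {subset take k [seq p <- hs | p.1 == e] <= hs}.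
    by move=> p /mem_take; rewrite mem_filter => /andP[].
  elim: (take k _) => [|p s IH] sub.
    by rewrite (_ : (fun t => _) = cst 1)//; apply/funext => t; rewrite big_nil.
  rewrite (_ : (fun t => _) = fun t =>
      expR (lam * (Y p.2 p.1 t - w e) - lam ^+ 2 * sg ^+ 2 / 2) *
      \prod_(p <- s) expR (lam * (Y p.2 p.1 t - w e) - lam ^+ 2 * sg ^+ 2 / 2));
    last by apply/funext => t; rewrite big_cons.
  apply: measurable_funM; last by apply: IH => q qs; apply: sub; rewrite inE qs orbT.
  apply: measurableT_comp => //; apply: measurable_funB => //.
  apply: measurable_funM => //; apply: measurable_funB => //.
  by apply: mY; apply: sub; rewrite mem_head.
have mexp : measurable_fun setT
    (fun x : R => expR (lam * (x - w e) - lam ^+ 2 * sg ^+ 2 / 2)).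
  apply: measurableT_comp => //; apply: measurable_funB => //.
  by apply: measurable_funM => //; apply: measurable_funB.
have [ae|ae] := eqVneq a e; last first.
  under eq_integral do rewrite /exp_mart arm_rewards_rcons (negbTE ae).
  by rewrite integral_cst_probability.
subst a; have [ks|sk] := leqP k (size (arm_rewards h e)).
  under eq_integral.
    move=> x _; rewrite /exp_mart arm_rewards_rcons eqxx -cats1 takel_cat//.
    over.
  by rewrite integral_cst_probability.
have takeE x : take k (rcons (arm_rewards h e) x) = rcons (take k (arm_rewards h e)) x.
  by rewrite !take_oversize ?size_rcons// ltnW.
under eq_integral.
  move=> x _; rewrite /exp_mart arm_rewards_rcons eqxx takeE -cats1 big_cat big_seq1/=.
  rewrite -/(exp_mart _ _ _ _) EFinM.
  over.
rewrite ge0_integralZl_EFin ?exp_mart_ge0//; last exact/measurable_EFinP.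
rewrite -[leRHS]mule1; apply: lee_wpmul2l; first by rewrite lee_fin exp_mart_ge0.
under eq_integral do rewrite expRD mulrC EFinM.
rewrite ge0_integralZl_EFin ?expR_ge0//; last first.
  apply/measurable_EFinP/measurableT_comp => //.
  by apply: measurable_funM => //; apply: measurable_funB.
apply: le_trans (lee_wpmul2l _ (subG e lam)) _; first by rewrite lee_fin expR_ge0.
by rewrite -EFinM lee_fin -expRD addNr expR0.
Qed.

Section Deviations.
Hypothesis sg0 : 0 < sg.
Hypothesis n0 : (0 < n)%N.
Variable eta : R.
Hypothesis eta1 : 0 < eta <= 100%:R^-1.

Let L (t : nat) : R := ln (4 * n%:R * t.+1%:R ^+ 3 / eta).

(* The tilt at which the Chernoff bound for [k.+1] samples reaches
   [expR (- L t)]. *)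
Let tilt t k : R := Num.sqrt (2 * L t / k.+1%:R) / sg.

(** A union bound turned into a single process: [t] is the length of a prefix, [k.+1] the number of
    plays of [e] in it, and the two tilts handle both signs of the error. [L t] is the logarithm in
    the radius of a history of size [t]. *)
Definition deviation (m : nat) h : R :=
  \sum_(t <- iota 0 m.+1) \sum_(e <- enum 'I_n) \sum_(k <- iota 0 t)
    expR (- L t) * (exp_mart (tilt t k) e k.+1 h + exp_mart (- tilt t k) e k.+1 h).

Lemma deviation_supermartingale m : supermartingale (deviation m).
Proof.
do 3![apply: supermartingale_sum => ?].
apply: supermartingaleZ; first exact: expR_ge0.
by apply: supermartingaleD; exact: exp_mart_supermartingale.
Qed.

Let expR_L t : expR (- L t) = eta / (4 * n%:R * t.+1%:R ^+ 3).
Proof.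
have n1 : 0 < n%:R :> R by rewrite ltr0n.
have /andP[e0 _] := eta1.
rewrite expRN lnK ?invf_div// posrE divr_gt0// mulr_gt0 ?exprn_gt0//.
by rewrite mulr_gt0.
Qed.

(** On the empty history every exponential is 1. What remains for each [t] is
    [2 * n * t * eta / (4 * n * (t + 1) ^ 3)], and [t / (t + 1) ^ 3 <= 1 / t - 1 / (t + 1)]
    telescopes. *)
Lemma deviation_nil m : deviation m [::] <= eta / 2.
Proof.
have n1 : 0 < n%:R :> R by rewrite ltr0n.
have /andP[e0 _] := eta1.
suff : deviation m [::] <= eta / 2 * (1 - m.+1%:R^-1).
  move=> h; apply: le_trans h _; rewrite -[leRHS]mulr1.
  apply: ler_wpM2l; first lra.
  by rewrite gerBl invr_ge0.
have termE t : \sum_(e <- enum 'I_n) \sum_(k <- iota 0 t)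
    expR (- L t) * (exp_mart (tilt t k) e k.+1 [::] + exp_mart (- tilt t k) e k.+1 [::])
    = eta / 2 * (t%:R / t.+1%:R ^+ 3).
  rewrite (eq_bigr (fun=> t%:R * (expR (- L t) * 2))); last first.
    move=> e _; rewrite (eq_bigr (fun=> expR (- L t) * 2)); last first.
      by move=> k _; rewrite /exp_mart !big_nil.
    by rewrite big_const_seq count_predT size_iota iter_addr_0 mulr_natl.
  rewrite big_const_seq count_predT -cardE card_ord iter_addr_0 -mulr_natl expR_L.
  by field; rewrite !gt_eqF.
rewrite /deviation (eq_bigr _ (fun t _ => termE t)).
elim: m => [|m IH].
  by rewrite big_seq1 mul0r invr1 subrr.
rewrite iota_rcons -cats1 big_cat big_seq1 add0n; apply: le_trans (lerD IH (lexx _)) _.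
rewrite -mulrDr; apply: ler_wpM2l; first lra.
have m0 : 0 < m.+1%:R :> R by [].
have -> : m.+2%:R = m.+1%:R + 1 :> R by rewrite -[in LHS]addn1 natrD.
move: (m.+1%:R : R) m0 => x x0; have x1 : 0 < x + 1 by lra.
suff : x / (x + 1) ^+ 3 <= x^-1 - (x + 1)^-1 by lra.
have -> : x^-1 - (x + 1)^-1 = (x * (x + 1))^-1 by field; rewrite !gt_eqF.
rewrite ler_pdivrMr ?exprn_gt0//.
have -> : (x * (x + 1))^-1 * (x + 1) ^+ 3 = (x + 1) ^+ 2 / x.
  by field; rewrite !gt_eqF.
by rewrite ler_pdivlMr//; nra.
Qed.

(** If an interval fails at a prefix of length [t] where [e] has [k.+1] plays, the summand for [t],
    [e], [k] is at least 1: at the tilt [r / sg], with the sign of the error, the exponent is at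
    least [2 * L t - L t - L t = 0]. *)
Lemma well_estimated_of_deviation m h : deviation m h < 1 -> (size h <= m)%N ->
  (forall g g', h = g ++ g' -> (n <= size g)%N -> forall e, (0 < nb_plays g e)%N) ->
  well_estimated w sg eta h.
Proof.
move=> dev hm np g g' hE ng e; rewrite leNgt; apply/negP => far.
move: dev; apply/negP; rewrite -leNgt.
have T0 := np g g' hE ng e.
set t := size g; set T := nb_plays g e in T0.
have Tt : (T <= t)%N by exact: count_size.
have tm : (t <= m)%N by rewrite (leq_trans _ hm)// hE size_cat leq_addr.
have TR : 0 < T%:R :> R by rewrite ltr0n.
have n1 : 1 <= n%:R :> R by rewrite ler1n.
have /andP[e0 e1] := eta1.
have L0 : 0 < L t.
  apply: ln_gt0.
  have k1 : 1 <= t.+1%:R ^+ 3 :> R by rewrite exprn_ege1// ler1n.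
  have ie : 1 < eta^-1 by rewrite -[1]invrK ltf_pV2 ?posrE ?invr_gt0//; lra.
  have : 1 <= n%:R * t.+1%:R ^+ 3 :> R by rewrite mulr_ege1.
  move=> ?; have : 1 <= 4 * n%:R * t.+1%:R ^+ 3 :> R by lra.
  by move: ie; nra.
have [k TE] : exists k, T = k.+1 by case: T T0 {Tt TR far} => // k _; exists k.
(* Freezing at work: the exponential evaluated at [h] sees only the rewards already present in
   [g]. *)
have takeE : take k.+1 (arm_rewards h e) = arm_rewards g e.
  rewrite hE /arm_rewards filter_cat map_cat take_size_cat//.
  by rewrite -/(arm_rewards g e) size_arm_rewards.
have expE lam : exp_mart lam e k.+1 h =
    expR (lam * (T%:R * (emp_mean g e - w e)) - T%:R * (lam ^+ 2 * sg ^+ 2 / 2)).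
  rewrite /exp_mart takeE -expR_sum; congr expR; rewrite sumrB; congr (_ - _).
    rewrite -mulr_sumr sumrB; congr (_ * _).
    rewrite big_map big_filter /emp_mean -/T mulrBr mulrC divfK ?gt_eqF//.
    congr (_ - _); rewrite big_const_seq count_predT size_map size_filter.
    by rewrite iter_addr_0 mulr_natl.
  rewrite big_const_seq count_predT size_map size_filter iter_addr_0 -/T.
  by rewrite mulr_natl.
have radE : Defs.rad sg eta g e = sg * Num.sqrt (2 * L t / T%:R) by [].
set r := Num.sqrt (2 * L t / T%:R) in radE.
have r2 : r ^+ 2 = 2 * L t / T%:R by rewrite sqr_sqrtr// divr_ge0// ?ltW// mulr_gt0.
have r0 : 0 < r by rewrite sqrtr_gt0 divr_gt0// mulr_gt0.
have big_exp lam : lam ^+ 2 = (r / sg) ^+ 2 ->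
    r / sg * `|emp_mean g e - w e| <= lam * (emp_mean g e - w e) ->
    1 <= expR (- L t) * exp_mart lam e k.+1 h.
  move=> lam2 lamd; rewrite expE -expRD -[leLHS]expR0 ler_expR lam2.
  have h1 : T%:R * ((r / sg) ^+ 2 * sg ^+ 2 / 2) = L t.
    rewrite exprMn exprVn divfK ?gt_eqF ?exprn_gt0// r2.
    by field; rewrite gt_eqF.
  have h2 : r / sg * (sg * r) * T%:R = 2 * L t.
    have -> : r / sg * (sg * r) = r ^+ 2 by field; rewrite gt_eqF.
    by rewrite r2; field; rewrite gt_eqF.
  have h3 : r / sg * (sg * r) <= r / sg * `|emp_mean g e - w e|.
    by apply: ler_wpM2l; [rewrite divr_ge0// ltW|rewrite -radE ltW].
  have : r / sg * (sg * r) * T%:R <= lam * (emp_mean g e - w e) * T%:R.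
    by apply: ler_wpM2r; [exact: ltW|exact: le_trans lamd].
  lra.
have term0 t' e' k' : 0 <= expR (- L t') *
    (exp_mart (tilt t' k') e' k'.+1 h + exp_mart (- tilt t' k') e' k'.+1 h).
  by rewrite mulr_ge0 ?expR_ge0// addr_ge0// exp_mart_ge0.
have tin : t \in iota 0 m.+1 by rewrite mem_iota.
have kin : k \in iota 0 t by rewrite mem_iota/= add0n -TE.
rewrite /deviation (big_rem _ tin)/= (big_rem e)/= ?mem_enum// (big_rem _ kin)/=.
have tiltE : tilt t k = r / sg by rewrite /tilt -TE.
have e10 lam : 0 <= expR (- L t) * exp_mart lam e k.+1 h.
  by rewrite mulr_ge0 ?expR_ge0// exp_mart_ge0.
rewrite -!addrA; apply: ler_wpDr.
  rewrite !addr_ge0//; apply: sumr_ge0 => *; rewrite ?sumr_ge0//.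
  by move=> *; apply: sumr_ge0 => *.
rewrite tiltE mulrDr.
have [d0|d0] := lerP 0 (emp_mean g e - w e).
  apply: ler_wpDr; first exact: e10.
  by apply: big_exp => //; rewrite ger0_norm.
apply: ler_wpDl; first exact: e10.
by apply: big_exp; [rewrite sqrrN|rewrite ltr0_norm// mulrN mulNr].
Qed.

End Deviations.
End Supermartingales.

(** * A reward is independent of the past *)

Section Past.
Context d (T : measurableType d) (R : realType) (P : probability T R) (n : nat).
Variable X : nat -> 'I_n -> {RV P >-> R}.

Definition past_cylinders (s : nat) : set (set T) :=
  [set A | exists (l : seq (nat * 'I_n)) (B : nat * 'I_n -> set R),
    [/\ uniq l, {in l, forall i, (i.1 < s)%N}, forall i, measurable (B i) &
        A = \big[setI/setT]_(i <- l) (X i.1 i.2 @^-1` B i)]].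

Notation past s := (g_sigma_algebraType (past_cylinders s)).

Lemma setI_closed_past_cylinders s : setI_closed (past_cylinders s).
Proof.
move=> _ _ [l1 [B1 [_ l1s mB1 ->]]] [l2 [B2 [_ l2s mB2 ->]]].
exists (undup (l1 ++ l2)), (fun i => (if i \in l1 then B1 i else setT) `&`
  (if i \in l2 then B2 i else setT)); split; first exact: undup_uniq.
- by move=> i; rewrite mem_undup mem_cat => /orP[/l1s|/l2s].
- by move=> i; apply: measurableI; case: ifP.
rewrite -!bigcap_seq; apply/seteqP; split=> [w [h1 h2] i /= _|w h /=].
  by split; case: ifPn => // il; [exact: h1|exact: h2].
split=> i /= il.
  by have := h i; rewrite /= mem_undup mem_cat il => /(_ isT)[+ _].
by have := h i; rewrite /= mem_undup mem_cat il orbT => /(_ isT)[_ +].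
Qed.

Lemma measurable_past_cylinders s : past_cylinders s `<=` measurable.
Proof.
move=> _ [l [B [_ _ mB ->]]]; apply: bigsetI_measurable => i _.
exact: measurable_funPTI.
Qed.

Lemma measurable_past s (A : set T) :
  measurable (A : set (past s)) -> measurable A.
Proof.
move: A; apply: smallest_sub; last exact: measurable_past_cylinders.
exact: sigma_algebra_measurable.
Qed.

Lemma measurable_past_id s : measurable_fun setT (id : T -> past s).
Proof. by move=> _ A mA; rewrite setTI preimage_id; exact: (@measurable_past s). Qed.

Lemma measurable_past_reward s i e : (i < s)%N ->
  measurable_fun setT (X i e : past s -> R).
Proof.
move=> si _ B mB; rewrite setTI; apply: sub_sigma_algebra.
exists [:: (i, e)], (fun=> B); split=> //; last by rewrite big_seq1.
by move=> j; rewrite inE => /eqP ->.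
Qed.

Lemma le_measurable_past s s' (A : set T) : (s <= s')%N ->
  measurable (A : set (past s)) -> measurable (A : set (past s')).
Proof.
move=> ss'; apply: sub_smallest2r => // _ [l [B [ul ls mB ->]]].
by exists l, B; split=> // i /ls /leq_trans; exact.
Qed.

Hypothesis indep : mutually_independent (fun i : nat * 'I_n => X i.1 i.2).

(** As functions of [A], both sides are finite measures that agree on a class of generators stable
    under intersection. On a cylinder, [B] is one more factor, at the index [(s, e)] that the
    cylinder cannot contain. *)
Lemma past_independent s e (A : set T) (B : set R) :
  measurable (A : set (past s)) -> measurable B ->
  P (A `&` X s e @^-1` B) = (P A * P (X s e @^-1` B))%E.
Proof.
move=> mA mB; have mE : measurable (X s e @^-1` B) by exact: measurable_funPTI.
have pE : 0 <= fine (P (X s e @^-1` B)) by rewrite fine_ge0.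
pose m1 := mrestr P mE.
pose m2 : {measure set T -> \bar R} := mscale (NngNum pE) P.
have m2E C : m2 C = (P C * P (X s e @^-1` B))%E.
  by rewrite /m2/= /mscale/= fineK ?fin_num_measure// muleC.
rewrite -m2E; change (m1 A = m2 A).
apply: (@g_sigma_algebra_measure_unique _ _ _ (past_cylinders s) _
  (fun=> setT)) => //.
- exact: measurable_past_cylinders.
- by move=> _; exists [::], (fun=> setT); split=> //; rewrite big_nil.
- by rewrite bigcup_const.
- exact: setI_closed_past_cylinders.
- move=> _ [l [C [ul ls mC ->]]]; rewrite m2E /m1/= /mrestr.
  pose D i := if i == (s, e) then B else C i.
  have nse : (s, e) \notin l by apply/negP => /ls/=; rewrite ltnn.
  have mD i : measurable (D i) by rewrite /D; case: ifP.
  have DC i : i \in l -> D i = C i.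
    by move=> il; rewrite /D; case: eqP => // ie; rewrite -ie il in nse.
  have := indep (s := (s, e) :: l) (B := D); rewrite !big_cons /= nse ul => /(_ isT mD).
  have -> : D (s, e) = B by rewrite /D eqxx.
  rewrite setIC muleC.
  have -> : \big[setI/setT]_(i <- l) (X i.1 i.2 @^-1` D i) =
            \big[setI/setT]_(i <- l) (X i.1 i.2 @^-1` C i).
    by apply: eq_big_seq => i il; rewrite DC.
  move=> ->; congr (_ * _)%E; rewrite indep//.
  by apply: eq_big_seq => i il; rewrite DC.
- by move=> _; rewrite /m1/= /mrestr setTI ltey_eq fin_num_measure.
Qed.

Variable nu : 'I_n -> probability R R.
Hypothesis law : forall s e (B : set R), measurable B ->
  distribution P (X s e) B = nu e B.

(** Takes the place of conditional expectation: the joint law of the past and the new reward is a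
    product, so Tonelli's theorem integrates the reward with the past held fixed. *)
Lemma integral_past_reward s e (f : past s * R -> \bar R) :
  measurable_fun setT f -> (forall z, 0 <= f z)%E ->
  (\int[P]_w f (w, X s e w) = \int[P]_w \int[nu e]_x f (w, x))%E.
Proof.
move=> mf f0.
pose idp : {RV P >-> past s} :=
  HB.pack (id : T -> past s) (isMeasurableFun.Build _ _ _ _ _ (@measurable_past_id s)).
have mJ : measurable_fun setT (fun w : T => (w : past s, X s e w)).
  by apply/measurable_fun_pairP; split => //=; exact: measurable_past_id.
pose J : {RV P >-> (past s * R)%type} :=
  HB.pack (fun w : T => (w : past s, X s e w))
    (isMeasurableFun.Build _ _ _ _ _ mJ).
have lawJ : forall C, measurable C ->
    (distribution P idp \x nu e)%E C = distribution P J C.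
  apply: product_measure_unique => A B mA mB.
  transitivity (P A * distribution P (X s e) B)%E.
    exact: past_independent.
  by congr (_ * _)%E; exact: law.
transitivity (\int[distribution P J]_z f z)%E.
  by rewrite ge0_integral_distribution.
transitivity (\int[(distribution P idp \x nu e)%E]_z f z)%E.
  by apply: eq_measure_integral => C mC _; exact/esym/lawJ.
rewrite fubini_tonelli1// /fubini_F ge0_integral_distribution//.
- exact: measurable_fun_fubini_tonelli_F.
- by move=> w; exact: integral_ge0.
Qed.

End Past.

(** * Measurability of the decisions *)

Section DiscreteMeasurable.
Context d (T : measurableType d).

Definition discretely_measurable (U : Type) (f : T -> U) : Prop :=
  forall u, measurable (f @^-1` [set u]).

Lemma discretely_measurable_cst (U : Type) (u : U) :
  discretely_measurable (fun=> u).
Proof. by move=> v; rewrite preimage_cst; case: ifP. Qed.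

Lemma discretely_measurable_bind (U : countType) (V : Type) (f : T -> U)
    (g : U -> T -> V) :
  discretely_measurable f -> (forall u, discretely_measurable (g u)) ->
  discretely_measurable (fun t => g (f t) t).
Proof.
move=> mf mg v; have -> : (fun t => g (f t) t) @^-1` [set v] =
    \bigcup_u (f @^-1` [set u] `&` g u @^-1` [set v]).
  by apply/seteqP; split=> [t <-|t [u _ [<- <-]]]//; exists (f t).
apply: countable_bigcupT_measurable => [|u]; first exact: countableP.
exact: measurableI (mf u) (mg u v).
Qed.

Lemma discretely_measurable_bool (b : T -> bool) :
  measurable_fun setT b -> discretely_measurable b.
Proof. by move=> mb u; rewrite -[X in measurable X]setTI; exact: mb. Qed.

Lemma discretely_measurable_set (U : finType) (b : U -> T -> bool) :
  (forall u, discretely_measurable (b u)) ->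
  discretely_measurable (fun t => [set u | b u t]%SET).
Proof.
move=> mb A; have -> : (fun t => [set u | b u t]%SET) @^-1` [set A] =
    \big[setI/setT]_(u <- enum U) (b u @^-1` [set u \in A]).
  rewrite -bigcap_seq; apply/seteqP; split=> [t /= <- u _ /=|t h].
    by rewrite inE.
  by apply/setP => u; rewrite inE; apply: (h u); rewrite /= mem_enum.
by apply: bigsetI_measurable => u _; exact: mb.
Qed.

Lemma discretely_measurable_vec (R : realType) n (U : Type)
    (v : T -> 'I_n -> R) (phi : ('I_n -> R) -> U) :
  (forall i, measurable_fun setT (v ^~ i)) ->
  (forall u, vec_measurable [set x | phi x = u]) ->
  discretely_measurable (fun t => phi (v t)).
Proof.
move=> mv mphi u.
rewrite [X in measurable X](_ : _ = v @^-1` [set x | phi x = u])//.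
have := mphi u; move: [set x | _] => A.
suff : @vec_measurable R n `<=` [set A | measurable (v @^-1` A)] by exact.
apply: smallest_sub; first split.
- by rewrite /= preimage_set0.
- by move=> B mB; rewrite /= setTD preimage_setC; exact: measurableC.
- by move=> B mB; rewrite /= preimage_bigcup; exact: bigcupT_measurable.
elim/big_ind: _ => //= [B C sB sC|i _].
  by rewrite subUset.
by move=> _ [B mB <-] /=; rewrite setTI -[X in measurable X]setTI; exact: mv.
Qed.

Lemma measurable_minW (R : realType) n (M : {set 'I_n}) (v : T -> 'I_n -> R) :
  (forall i, measurable_fun setT (v ^~ i)) ->
  measurable_fun setT (fun t => minW M (v t)).
Proof.
move=> mv; rewrite /minW; elim: (index_enum _) => [|i s IH].
  by rewrite (_ : (fun t => _) = cst +oo%E)//; apply/funext => t; rewrite big_nil.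
rewrite (_ : (fun t => _) = fun t => if i \in M
    then mine (v t i)%:E (\big[mine/+oo%E]_(e <- s | e \in M) (v t e)%:E)
    else \big[mine/+oo%E]_(e <- s | e \in M) (v t e)%:E); last first.
  by apply/funext => t; rewrite big_cons.
case: (i \in M) => //; apply: measurable_mine => //.
by apply/measurable_EFinP; exact: mv.
Qed.

End DiscreteMeasurable.

Section HistoryMeasurable.
Context (R : realType) (n : nat) d (T : measurableType d).
Variables (Y : nat -> 'I_n -> T -> R) (hs : seq ('I_n * nat)).
Hypothesis mY : {in hs, forall p, measurable_fun setT (Y p.2 p.1)}.
Let hist t := realize hs (fun i e => Y i e t).

Lemma size_realize (x : nat -> 'I_n -> R) : size (realize hs x) = size hs.
Proof. exact: size_map. Qed.

Lemma nb_plays_realize (x : nat -> 'I_n -> R) e :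
  nb_plays (realize hs x) e = count (fun p => p.1 == e) hs.
Proof. by rewrite /nb_plays /realize count_map. Qed.

Lemma measurable_emp_mean e : measurable_fun setT (fun t => emp_mean (hist t) e).
Proof.
rewrite /emp_mean; apply: measurable_funM; last first.
  by under eq_fun do rewrite nb_plays_realize; exact: measurable_cst.
have : {subset hs <= hs} by [].
rewrite (_ : (fun t => _) = fun t => \sum_(p <- hs | p.1 == e) Y p.2 p.1 t); last first.
  by apply/funext => t; rewrite big_map.
elim: {1 3}hs => [|p s IH] sub.
  by rewrite (_ : (fun t => _) = cst 0)//; apply/funext => t; rewrite big_nil.
have {}IH := IH (fun q qs => sub q (mem_behead (s := p :: s) qs)).
rewrite (_ : (fun t => _) = fun t => if p.1 == e
    then Y p.2 p.1 t + \sum_(p <- s | p.1 == e) Y p.2 p.1 t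
    else \sum_(p <- s | p.1 == e) Y p.2 p.1 t); last first.
  by apply/funext => t; rewrite big_cons.
case: (p.1 == e) => //; apply: measurable_funD => //.
by apply: mY; apply: sub; rewrite mem_head.
Qed.

Lemma measurable_rad (sg eta : R) e :
  measurable_fun setT (fun t => Defs.rad sg eta (hist t) e).
Proof.
rewrite /Defs.rad; under eq_fun do rewrite nb_plays_realize size_realize.
exact: measurable_cst.
Qed.

Lemma measurable_lcb (sg eta : R) e :
  measurable_fun setT (fun t => lcb sg eta (hist t) e).
Proof.
exact: (measurable_funB (measurable_emp_mean e) (measurable_rad sg eta e)).
Qed.

Lemma measurable_ucb (sg eta : R) e :
  measurable_fun setT (fun t => ucb sg eta (hist t) e).
Proof.
exact: (measurable_funD (measurable_emp_mean e) (measurable_rad sg eta e)).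
Qed.

Variables (F : {set {set 'I_n}}) (sg : R) (sub : subroutines R n).
Hypothesis msub : subroutines_measurable sub.

(** The stopping test becomes emptiness of the set of violators, so the decision factors through
    finitely valued quantities. *)
Lemma explore_loopE (h : history R n) (lo := lcb sg 100%:R^-1 h)
    (M := max_oracle sub F lo) (B := bottleneck_search sub F M lo)
    (B' := [set e in B |
      (2^-1%:E * (minW M lo + (lo e)%:E) < (ucb sg 100%:R^-1 h e)%:E)%E]%SET) :
  explore_loop F sg sub h = if B' == finset.set0 then Return (M, B)
    else Play (Defs.arg_max sub (Defs.arg_min sub M lo |: B')
                (Defs.rad sg 100%:R^-1 h)).
Proof.
rewrite /explore_loop -/lo -/M -/B -/B'; congr (if _ then _ else _).
apply/'forall_implyP/eqP => [small|B'0 e eB].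
  apply/setP => e; rewrite !inE; apply/negP => /andP[/small].
  by rewrite leNgt => /negbTE ->.
rewrite leNgt; apply/negP => big.
suff : e \in B' by rewrite B'0 inE.
by rewrite inE eB.
Qed.

(** The finite choices are fixed one at a time, in the order of their computation; each next routine
    then varies only through a real vector. [K] allows later processing of the action into any
    type. *)
Lemma discretely_measurable_explore (V : Type)
    (K : action n ({set 'I_n} * {set 'I_n}) -> V) :
  discretely_measurable (fun t => K (explore F sg sub (hist t))).
Proof.
rewrite /explore; under eq_fun do rewrite size_realize.
case: insubP => [e _ _|_]; first exact: discretely_measurable_cst.
under eq_fun do rewrite explore_loopE.
have [mmo mbs mmin mmax] := msub.
pose lo t := lcb sg 100%:R^-1 (hist t).
have mlo e : measurable_fun setT (lo ^~ e) by exact: measurable_lcb.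
pose Bf (M B : {set 'I_n}) t := [set e in B | (2^-1%:E * (minW M (lo t) + (lo t e)%:E) <
  (ucb sg 100%:R^-1 (hist t) e)%:E)%E]%SET.
rewrite -/(discretely_measurable _).
refine (@discretely_measurable_bind _ _ {set 'I_n} _ (fun t => max_oracle sub F (lo t))
  (fun M t => let B := bottleneck_search sub F M (lo t) in
     K (if Bf M B t == finset.set0 then Return (M, B)
        else Play (Defs.arg_max sub (Defs.arg_min sub M (lo t) |: Bf M B t)
             (Defs.rad sg 100%:R^-1 (hist t))))) _ _).
  exact: discretely_measurable_vec.
move=> M; refine (@discretely_measurable_bind _ _ {set 'I_n} _
  (fun t => bottleneck_search sub F M (lo t))
  (fun B t =>
     K (if Bf M B t == finset.set0 then Return (M, B)
        else Play (Defs.arg_max sub (Defs.arg_min sub M (lo t) |: Bf M B t)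
             (Defs.rad sg 100%:R^-1 (hist t))))) _ _).
  exact: discretely_measurable_vec.
move=> B; refine (@discretely_measurable_bind _ _ {set 'I_n} _ (Bf M B)
  (fun B' t =>
     K (if B' == finset.set0 then Return (M, B)
        else Play (Defs.arg_max sub (Defs.arg_min sub M (lo t) |: B')
             (Defs.rad sg 100%:R^-1 (hist t))))) _ _).
  apply: discretely_measurable_set => e.
  case: (e \in B); last exact: discretely_measurable_cst.
  apply: discretely_measurable_bool; apply: measurable_fun_lte.
    apply: emeasurable_funM => //; apply: emeasurable_funD.
      exact: measurable_minW.
    exact/measurable_EFinP.
  by apply/measurable_EFinP; exact: measurable_ucb.
move=> B'; refine (@discretely_measurable_bind _ _ 'I_n _
  (fun t => Defs.arg_min sub M (lo t))
  (fun c t =>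
     K (if B' == finset.set0 then Return (M, B)
        else Play (Defs.arg_max sub (c |: B') (Defs.rad sg 100%:R^-1 (hist t))))) _ _).
  exact: discretely_measurable_vec.
move=> c; refine (@discretely_measurable_bind _ _ 'I_n _
  (fun t => Defs.arg_max sub (c |: B') (Defs.rad sg 100%:R^-1 (hist t)))
  (fun p t => K (if B' == finset.set0 then Return (M, B) else Play p)) _ _).
  by apply: discretely_measurable_vec => // i; exact: measurable_rad.
by move=> p; exact: discretely_measurable_cst.
Qed.

Lemma discretely_measurable_verify (V : Type) (eta : R) (M B : {set 'I_n})
    (K : action n {set 'I_n} -> V) :
  discretely_measurable (fun t => K (verify_fresh F sg sub eta M B (hist t))).
Proof.
rewrite /verify_fresh; under eq_fun do rewrite size_realize.
case: insubP => [e _ _|_]; first exact: discretely_measurable_cst.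
have [mmo mbs mmin mmax] := msub.
pose lo t := lcb sg eta (hist t).
pose up t := ucb sg eta (hist t).
have mlo e : measurable_fun setT (lo ^~ e) by exact: measurable_lcb.
have mup e : measurable_fun setT (up ^~ e) by exact: measurable_ucb.
pose G := F :\: supersets M.
refine (@discretely_measurable_bind _ _ {set 'I_n} _ (fun t => max_oracle sub G (up t))
  (fun Mt t => K (if (G == finset.set0) || (minW Mt (up t) <= minW M (lo t))%E
    then Return M else
    let c := Defs.arg_min sub M (lo t) in
    Play (Defs.arg_max sub (c |: [set e in B | lo t c < up t e]%SET)
      (Defs.rad sg eta (hist t))))) _ _).
  exact: discretely_measurable_vec.
move=> Mt; refine (@discretely_measurable_bind _ _ bool _
  (fun t => (minW Mt (up t) <= minW M (lo t))%E)
  (fun b t => K (if (G == finset.set0) || b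
    then Return M else
    let c := Defs.arg_min sub M (lo t) in
    Play (Defs.arg_max sub (c |: [set e in B | lo t c < up t e]%SET)
      (Defs.rad sg eta (hist t))))) _ _).
  apply: discretely_measurable_bool; apply: measurable_fun_lee;
  exact: measurable_minW.
move=> b; refine (@discretely_measurable_bind _ _ 'I_n _
  (fun t => Defs.arg_min sub M (lo t))
  (fun c t => K (if (G == finset.set0) || b then Return M else
    Play (Defs.arg_max sub (c |: [set e in B | lo t c < up t e]%SET)
      (Defs.rad sg eta (hist t))))) _ _).
  exact: discretely_measurable_vec.
move=> c; refine (@discretely_measurable_bind _ _ {set 'I_n} _
  (fun t => [set e in B | lo t c < up t e]%SET)
  (fun Ft t => K (if (G == finset.set0) || b then Return M else
    Play (Defs.arg_max sub (c |: Ft) (Defs.rad sg eta (hist t))))) _ _).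
  apply: discretely_measurable_set => e.
  case: (e \in B); last exact: discretely_measurable_cst.
  by apply: discretely_measurable_bool; exact: measurable_fun_ltr.
move=> Ft; refine (@discretely_measurable_bind _ _ 'I_n _
  (fun t => Defs.arg_max sub (c |: Ft) (Defs.rad sg eta (hist t)))
  (fun p t => K (if (G == finset.set0) || b then Return M else Play p)) _ _).
  by apply: discretely_measurable_vec => // i; exact: measurable_rad.
by move=> p; exact: discretely_measurable_cst.
Qed.

End HistoryMeasurable.

(** * Symbolic runs *)

Section SymbolicRun.
Context (R : realType) (n : nat).
Variables (F : {set {set 'I_n}}) (sg : R) (sub : subroutines R n) (delta : R).
Let deltaV k : R := delta / 2 ^+ k.+1.

(* The exploration history is kept once verification has started: the
   supermartingales attached to a copy still depend on it. *)
Record trace := Trace {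
  explored : seq ('I_n * nat);
  explore_output : option ({set 'I_n} * {set 'I_n});
  verified : seq ('I_n * nat) }.

Record run := Run {
  traces : nat -> trace;
  drawn : nat;
  output : option {set 'I_n} }.

Definition run_init : run := Run (fun=> Trace [::] None [::]) 0 None.

Definition entries (c : trace) := explored c ++ verified c.

Definition trace_state (c : trace) (x : nat -> 'I_n -> R) : verify_state R n :=
  if explore_output c is Some (M, B) then Verifying M B (realize (verified c) x)
  else Exploring (realize (explored c) x).

Definition run_state (D : run) (x : nat -> 'I_n -> R) : parallel_state R n :=
  ParallelState (fun k => trace_state (traces D k) x) (drawn D) (output D).

(** All that determines the next symbolic state: an answer, or an arm together with the exploration
    output if the sample belongs to verification. The type is finite, so events split into finitely
    many pieces. *)
Definition decision : Type :=
  ({set 'I_n} + 'I_n * option ({set 'I_n} * {set 'I_n}))%type.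

Definition decide_fresh eta (M B : {set 'I_n}) (h : history R n) : decision :=
  match verify_fresh F sg sub eta M B h with
  | Return M' => inl M'
  | Play e => inr (e, Some (M, B))
  end.

Definition decide eta (c : trace) (x : nat -> 'I_n -> R) : decision :=
  if explore_output c is Some (M, B)
  then decide_fresh eta M B (realize (verified c) x)
  else match explore F sg sub (realize (explored c) x) with
    | Play e => inr (e, None)
    | Return (M, B) => decide_fresh eta M B [::]
    end.

Definition extend (c : trace) (s : nat) (e : 'I_n)
    (o : option ({set 'I_n} * {set 'I_n})) : trace :=
  if o is Some MB then Trace (explored c) (Some MB) (rcons (verified c) (e, s))
  else Trace (rcons (explored c) (e, s)) (explore_output c) (verified c).

Definition set_trace (D : run) k c : nat -> trace :=
  fun j => if j == k then c else traces D j.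

Definition perform (D : run) (k : nat) (a : decision) : run :=
  match a with
  | inl M => Run (traces D) (drawn D) (Some M)
  | inr (e, o) =>
      Run (set_trace D k (extend (traces D k) (drawn D) e o)) (drawn D).+1 None
  end.

Definition run_slot (x : nat -> 'I_n -> R) (D : run) (k : nat) : run :=
  if output D is Some _ then D
  else perform D k (decide (deltaV k) (traces D k) x).

Lemma run_slot_stopped x D k M : output D = Some M -> run_slot x D k = D.
Proof. by rewrite /run_slot => ->. Qed.

Lemma run_slot_running x D k : output D = None ->
  run_slot x D k = perform D k (decide (deltaV k) (traces D k) x).
Proof. by rewrite /run_slot => ->. Qed.

(** Recorded timesteps precede the next draw, which makes decisions functions of the past. *)
Definition valid (D : run) : Prop :=
  forall k, {in entries (traces D k), forall p, p.2 < drawn D}%N /\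
    (explore_output (traces D k) = None -> verified (traces D k) = [::]).

Lemma realize_rcons hs e s (x : nat -> 'I_n -> R) :
  realize (rcons hs (e, s)) x = rcons (realize hs x) (e, x s e).
Proof. by rewrite /realize map_rcons. Qed.

Lemma valid_init : valid run_init.
Proof. by move=> k; split. Qed.

Lemma entries_perform D k e o j : valid D ->
  {in entries (traces (perform D k (inr (e, o))) j),
    forall p, p = (e, drawn D) \/ (p.2 < drawn D)%N}.
Proof.
move=> vD p; rewrite /= /set_trace; case: eqP => _; last by move/(vD j).1; right.
have vk := (vD k).1; rewrite /extend; case: o => [MB|] /=.
  rewrite /entries /= mem_cat mem_rcons inE => /or3P[pE|/eqP->|pV]; first 2 last.
  - by right; apply: vk; rewrite mem_cat pV orbT.
  - by right; apply: vk; rewrite mem_cat pE.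
  by left.
rewrite /entries /= mem_cat mem_rcons inE => /orP[/orP[/eqP->|pE]|pV].
- by left.
- by right; apply: vk; rewrite mem_cat pE.
- by right; apply: vk; rewrite mem_cat pV orbT.
Qed.

Lemma valid_perform D k a : valid D -> valid (perform D k a).
Proof.
move=> vD; case: a => [M|[e o]] j; first exact: vD.
split=> [p /(entries_perform vD)[->//|/ltnW//]|] /=.
rewrite /set_trace; case: eqP => _; last exact: (vD j).2.
by rewrite /extend; case: o => //=; exact: (vD k).2.
Qed.

Lemma valid_run_slot x D k : valid D -> valid (run_slot x D k).
Proof. by rewrite /run_slot; case: (output D) => // vD; exact: valid_perform. Qed.

Lemma run_state_slot x D k : valid D ->
  run_state (run_slot x D k) x =
  parallel_slot F sg sub delta x (run_state D x) k.
Proof.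
move=> vD; rewrite /run_slot /parallel_slot /=.
case: (output D) => //.
have freshE M B h : resume_fresh F sg sub (deltaV k) M B h =
    match decide_fresh (deltaV k) M B h with
    | inl M' => Answer _ M'
    | inr (e, _) => Sample e (fun y => Verifying M B (rcons h (e, y)))
    end by rewrite /resume_fresh /decide_fresh; case: verify_fresh.
have fresh_inr M B h e o :
    decide_fresh (deltaV k) M B h = inr (e, o) -> o = Some (M, B).
  by rewrite /decide_fresh; case: verify_fresh => // e' [_ <-].
rewrite {1}/trace_state /decide; have [_ ver0] := vD k.
have stE j c : trace_state (set_trace D k c j) x =
    if j == k then trace_state c x else trace_state (traces D j) x.
  by rewrite /set_trace; case: eqP.
case cE : (explore_output (traces D k)) => [[M B]|] /=.
  rewrite freshE; case aE : decide_fresh => [M'|[e o]] //=.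
  rewrite /run_state /= (fresh_inr _ _ _ _ _ aE); congr ParallelState.
  apply/funext => j; rewrite stE; case: eqP => // _.
  by rewrite /trace_state /= realize_rcons.
case: explore => [e|[M B]] /=.
  rewrite /run_state /=; congr ParallelState.
  apply/funext => j; rewrite stE; case: eqP => // _.
  by rewrite /trace_state /= cE realize_rcons.
rewrite freshE; case aE : decide_fresh => [M'|[e o]] //=.
rewrite /run_state /= (fresh_inr _ _ _ _ _ aE); congr ParallelState.
apply/funext => j; rewrite stE; case: eqP => // _.
by rewrite /trace_state /= realize_rcons ver0.
Qed.

Lemma run_state_slots x D l : valid D ->
  run_state (foldl (run_slot x) D l) x =
  foldl (parallel_slot F sg sub delta x) (run_state D x) l.
Proof.
elim: l D => //= k l IH D vD.
by rewrite IH ?run_state_slot//; exact: valid_run_slot.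
Qed.

Definition slots (t : nat) : seq nat :=
  flatten [seq [seq k <- iota 0 t' | (2 ^ k %| t')%N] | t' <- iota 1 t].

Lemma slotsS t : slots t.+1 = slots t ++ [seq k <- iota 0 t.+1 | (2 ^ k %| t.+1)%N].
Proof. by rewrite /slots iota_rcons map_rcons flatten_rcons add1n. Qed.

Lemma parallel_run_slots x t :
  parallel_run F sg sub delta x t =
  run_state (foldl (run_slot x) run_init (slots t)) x.
Proof.
rewrite run_state_slots; last exact: valid_init.
elim: t => [|t IH] //.
by rewrite slotsS foldl_cat -IH.
Qed.

Section Measurability.
Hypothesis msub : subroutines_measurable sub.

Lemma discretely_measurable_decide d (T : measurableType d)
    (Y : nat -> 'I_n -> T -> R) eta c :
  {in entries c, forall p, measurable_fun setT (Y p.2 p.1)} ->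
  discretely_measurable (fun t => decide eta c (fun i e => Y i e t)).
Proof.
move=> mY; rewrite /decide; case: (explore_output c) => [[M B]|].
  apply: (discretely_measurable_verify _ F sg msub eta M B (fun a => match a with
    | Return M' => inl M' | Play e => inr (e, Some (M, B)) end)).
  by move=> p pc; apply: mY; rewrite mem_cat pc orbT.
apply: (discretely_measurable_explore _ F sg msub (fun a => match a with
  | Play e => inr (e, None)
  | Return (M, B) => decide_fresh eta M B [::] end)).
by move=> p pc; apply: mY; rewrite mem_cat pc.
Qed.

Lemma measurable_run d (T : measurableType d) (Y : nat -> 'I_n -> T -> R)
    (Q : run -> set T) D l :
  (forall i e, measurable_fun setT (Y i e)) ->
  (forall D, valid D -> measurable (Q D)) -> valid D ->
  measurable [set t | Q (foldl (run_slot (fun i e => Y i e t)) D l) t].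
Proof.
move=> mY mQ; elim: l D => [|k l IH] D vD; first exact: mQ.
rewrite /=; have -> : [set t | Q (foldl (run_slot (fun i e => Y i e t))
      (run_slot (fun i e => Y i e t) D k) l) t] =
    if output D is Some _
    then [set t | Q (foldl (run_slot (fun i e => Y i e t)) D l) t]
    else \bigcup_a
     ([set t | decide (deltaV k) (traces D k) (fun i e => Y i e t) = a] `&`
      [set t | Q (foldl (run_slot (fun i e => Y i e t)) (perform D k a) l) t]).
  rewrite /run_slot; case: (output D) => [M//|].
  by apply/seteqP; split=> [t h|t [a _ [/= -> h]]]//; eexists.
case: (output D) => [M|]; first exact: IH.
apply: countable_bigcupT_measurable => [|a]; first exact: countableP.
apply: measurableI; last by apply: IH; exact: valid_perform.
exact: discretely_measurable_decide.
Qed.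

End Measurability.
End SymbolicRun.

(** * The maximal inequality *)

Section Partition.
Context d (T : measurableType d) (R : realType) (P : probability T R).

Lemma integral_split (U : finType) (g : T -> U) (G : set T) (f : T -> \bar R) :
  discretely_measurable g -> measurable G -> measurable_fun G f ->
  (forall t, 0 <= f t)%E ->
  (\int[P]_(t in G) f t = \sum_(u : U) \int[P]_(t in G `&` g @^-1` [set u]) f t)%E.
Proof.
move=> mg mG mf f0.
have GE : \big[setU/set0]_(u : U) (G `&` g @^-1` [set u]) = G.
  rewrite -bigcup_seq; apply/seteqP; split=> [t [u _ []]//|t Gt].
  by exists (g t) => //=; rewrite mem_index_enum.
rewrite -{1}GE ge0_integral_bigsetU//.
- by move=> u; apply: measurableI => //; exact: mg.
- exact: index_enum_uniq.
- by move=> u v _ _ [t [[_ <-] [_ <-]]].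
- by rewrite GE.
Qed.

Lemma probability_integral (A : set T) : measurable A ->
  (P A = \int[P]_(t in A) 1%:E)%E.
Proof. by move=> mA; rewrite integral_cst// mul1e. Qed.

Lemma probability_split (U : finType) (g : T -> U) (A : set T) :
  discretely_measurable g -> measurable A ->
  (P A = \sum_(u : U) P (A `&` g @^-1` [set u]))%E.
Proof.
move=> mg mA; rewrite probability_integral// (integral_split mg)//.
by apply: eq_bigr => u _; rewrite probability_integral//; exact: measurableI.
Qed.

End Partition.

Section Maximal.
Context (R : realType) (n : nat).
Variables (F : {set {set 'I_n}}) (sg : R) (sub : subroutines R n) (delta : R).
Hypothesis msub : subroutines_measurable sub.
Variable nu : 'I_n -> probability R R.

Definition set_reward (x : nat -> 'I_n -> R) s e y : nat -> 'I_n -> R :=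
  fun i e' => if (i == s) && (e' == e) then y else x i e'.

Lemma set_reward_id x s e : set_reward x s e (x s e) = x.
Proof.
apply/funext => i; apply/funext => e'; rewrite /set_reward.
by case: andP => // -[/eqP-> /eqP->].
Qed.

Definition run_supermartingale (Z : run n -> (nat -> 'I_n -> R) -> R) : Prop :=
  [/\ forall D x, 0 <= Z D x,
      forall D o x, Z (Run (traces D) (drawn D) o) x = Z D x,
      forall d (T : measurableType d) (Y : nat -> 'I_n -> T -> R) D,
        (forall k, {in entries (traces D k),
          forall p, measurable_fun setT (Y p.2 p.1)}) ->
        measurable_fun setT (fun t => Z D (fun i e => Y i e t)) &
      forall D k e o x, valid D ->
        (\int[nu e]_y (Z (perform D k (inr (e, o))) (set_reward x (drawn D) e y))%:E
           <= (Z D x)%:E)%E].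

Context d (T : measurableType d) (P : probability T R).
Variable X : nat -> 'I_n -> {RV P >-> R}.
Hypothesis rewards : reward_process nu X.
Let rw (t : T) i e : R := X i e t.

Variable Z : run n -> (nat -> 'I_n -> R) -> R.
Hypothesis supZ : run_supermartingale Z.

Let Z_ge0 D x : 0 <= Z D x. Proof. by case: supZ. Qed.

Lemma measurable_run_supermartingale D : measurable_fun setT (fun t => Z D (rw t)).
Proof. by case: supZ => _ _ mZ _; apply: mZ => k p _. Qed.

(** The conditional form of the supermartingale property: [G] is a past event, and the new state
    reads a single reward outside the past, which independence replaces by a variable of law
    [nu e]. *)
Lemma perform_supermartingale D k a (G : set T) : valid D ->
  measurable (G : set (g_sigma_algebraType (past_cylinders X (drawn D)))) ->
  (\int[P]_(t in G) (Z (perform D k a) (rw t))%:E <=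
   \int[P]_(t in G) (Z D (rw t))%:E)%E.
Proof.
move=> vD mG; have [_ Zo mZ Zstep] := supZ; have mG' := measurable_past mG.
case: a => [M|[e o]].
  by under eq_integral do rewrite Zo.
rewrite integral_mkcond [leRHS]integral_mkcond !epatch_indic.
set D' := perform D k _; set s := drawn D in mG *.
pose past_s := g_sigma_algebraType (past_cylinders X s).
pose Y i (e' : 'I_n) (z : past_s * R) : R :=
  if (i == s) && (e' == e) then z.2 else X i e' z.1.
pose f (z : past_s * R) : \bar R :=
  ((Z D' (fun i e' => Y i e' z))%:E * (\1_G z.1)%:E)%E.
have mf : measurable_fun setT f.
  apply: emeasurable_funM.
    apply/measurable_EFinP; apply: mZ => j p pj; rewrite /Y.
    have [ps|] := boolP ((p.2 == s) && (p.1 == e)); first exact: measurable_snd.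
    move=> ps; apply: (measurableT_comp (f := X p.2 p.1 : past_s -> R)) measurable_fst.
    apply: measurable_past_reward.
    have [pE|//] := entries_perform vD pj.
    by move: ps; rewrite pE !eqxx.
  apply/measurable_EFinP; apply: measurableT_comp measurable_fst.
  exact: measurable_indic.
have f0 z : (0 <= f z)%E by rewrite mule_ge0// lee_fin.
have [law indep] := rewards.
rewrite [leLHS](_ : _ = \int[P]_t f (t, X s e t))%E; last first.
  apply: eq_integral => t _; rewrite /f /=; congr (_%:E * _)%E; congr (Z D' _).
  exact/esym/(set_reward_id (rw t) s e).
rewrite (integral_past_reward indep law e mf f0).
apply: ge0_le_integral => //.
- by move=> t _; exact: integral_ge0.
- have h : measurable_fun setT (fubini_F (nu e) f).
    exact: measurable_fun_fubini_tonelli_F.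
  exact: (measurableT_comp h (measurable_past_id (X := X) (s := s))).
- apply: emeasurable_funM; apply/measurable_EFinP.
    exact: measurable_run_supermartingale.
  exact: measurable_indic.
move=> t _; rewrite /f /=.
under eq_integral do rewrite muleC.
rewrite ge0_integralZl_EFin//; last 2 first.
- by move=> y _; rewrite lee_fin.
- apply/measurable_EFinP; apply: (mZ _ _ (fun i e' y => Y i e' (t, y))) => j p pj.
  by rewrite /Y/=; case: (_ && _).
rewrite muleC; apply: lee_wpmul2r; first by rewrite lee_fin.
exact: (Zstep D k e o (rw t) vD).
Qed.

(* Given the symbolic state, the next decision takes finitely many values and is
   determined by the past; on each of these events the next state is fixed. *)
Lemma run_maximal D l (G : set T) : valid D ->
  measurable (G : set (g_sigma_algebraType (past_cylinders X (drawn D)))) ->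
  (P (G `&` [set t | (1 <= Z (foldl (run_slot F sg sub delta (rw t)) D l) (rw t))%R])
   <= \int[P]_(t in G) (Z D (rw t))%:E)%E.
Proof.
elim: l D G => [|k l IH] D G vD mG; have mG' := measurable_past mG.
  rewrite /=; set A := G `&` _; have mA : measurable A.
    apply: measurableI => //; rewrite -[X in measurable X]setTI.
    have := measurable_run_supermartingale D; move=> /(_ measurableT `[1, +oo[%classic).
    rewrite (_ : _ @^-1` _ = [set t | 1 <= Z D (rw t)]); first by apply.
    by apply/seteqP; split=> t; rewrite /= in_itv/= andbT.
  rewrite probability_integral//.
  (* Markov's inequality, as [Z] is at least 1 on [A]. *)
  apply: (@le_trans _ _ (\int[P]_(t in A) (Z D (rw t))%:E)%E).
    apply: ge0_le_integral => //.
    - apply/measurable_EFinP; apply: measurable_funTS.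
      exact: measurable_run_supermartingale.
    - by move=> t [_ /=]; rewrite lee_fin.
  apply: ge0_subset_integral => //.
  - by apply/measurable_EFinP; apply: measurable_funTS; exact: measurable_run_supermartingale.
  - by move=> t _; rewrite lee_fin.
  - exact: subIsetl.
rewrite /=; case outE : (output D) => [M|].
  rewrite (_ : [set t | _] = [set t |
      (1 <= Z (foldl (run_slot F sg sub delta (rw t)) D l) (rw t))%R]); first exact: IH.
  by apply/seteqP; split=> t /=; rewrite (run_slot_stopped _ _ _ _ _ _ outE).
pose g t := decide F sg sub (delta / 2 ^+ k.+1) (traces D k) (rw t).
have mg : discretely_measurable g by apply: discretely_measurable_decide => // p _.
have mg' : forall a, measurable (g @^-1` [set a] :
    set (g_sigma_algebraType (past_cylinders X (drawn D)))).
  apply: (discretely_measurable_decide F sg _ (Y := fun i e =>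
    (X i e : g_sigma_algebraType (past_cylinders X (drawn D)) -> R))) => // p pk.
  by apply: measurable_past_reward; exact: (vD k).1.
set A := G `&` _.
have mA : measurable A.
  apply: measurableI => //.
  have -> : [set t | (1 <= Z (foldl (run_slot F sg sub delta (rw t))
      (run_slot F sg sub delta (rw t) D k) l) (rw t))%R] =
    [set t | [set t | 1 <= Z (foldl (run_slot F sg sub delta (rw t)) D (k :: l)) (rw t)] t].
    by [].
  apply: (@measurable_run _ _ F sg sub delta msub _ _ (fun i e => X i e)
    (fun D => [set t | 1 <= Z D (rw t)]) D (k :: l)) => // D' _.
  rewrite -[X in measurable X]setTI.
  have := measurable_run_supermartingale D'; move=> /(_ measurableT `[1, +oo[%classic).
  rewrite (_ : _ @^-1` _ = [set t | 1 <= Z D' (rw t)]); first by apply.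
  by apply/seteqP; split=> t; rewrite /= in_itv/= andbT.
rewrite (probability_split P mg mA) (integral_split P mg mG'); last 2 first.
- apply/measurable_EFinP; apply: measurable_funTS.
  exact: measurable_run_supermartingale.
- by move=> t; rewrite lee_fin.
apply: lee_sum => a _.
have mGa : measurable (G `&` g @^-1` [set a] :
    set (g_sigma_algebraType (past_cylinders X (drawn D)))).
  exact: measurableI.
apply: le_trans (perform_supermartingale k a vD mGa).
apply: le_trans (IH (perform D k a) _ (valid_perform _ _ vD) _); last first.
  apply: le_measurable_past mGa.
  by case: (a) => [M|[e o]] /=.
rewrite le_eqVlt; apply/orP; left; apply/eqP; congr (P _).
rewrite /A; apply/seteqP; split=> t [] /=.
  by move=> [Gt]; rewrite run_slot_running// -/(g t) => + ga; rewrite ga.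
move=> [Gt ga]; split=> //; split=> //.
by rewrite run_slot_running// -/(g t) ga.
Qed.

Lemma run_maximal_init l (c : R) :
  (forall x, Z (run_init n) x <= c) ->
  (P [set t | (1 <= Z (foldl (run_slot F sg sub delta (rw t)) (run_init n) l) (rw t))%R]
   <= c%:E)%E.
Proof.
move=> Zc; rewrite -[X in P X]setTI; apply: le_trans (run_maximal l _ _) _ => //.
- by rewrite -(integral_cst_probability P c); apply: ge0_le_integral => //;
    rewrite ?integral_cst_probability//;
    [move=> t _; rewrite lee_fin|apply/measurable_EFinP; exact: measurable_run_supermartingale
    |move=> t _; rewrite lee_fin].
Qed.

End Maximal.

(** * Supermartingales of one copy, and their products and sums over copies *)

Section TraceSupermartingales.
Context (R : realType) (n : nat).
Variable nu : 'I_n -> probability R R.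
Implicit Types (c : trace n -> (nat -> 'I_n -> R) -> R) (x : nat -> 'I_n -> R).

(** The third condition is locality: a reward drawn by another copy leaves the value unchanged. *)
Definition trace_supermartingale c : Prop :=
  [/\ forall t x, 0 <= c t x,
      forall d (T : measurableType d) (Y : nat -> 'I_n -> T -> R) t,
        {in entries t, forall p, measurable_fun setT (Y p.2 p.1)} ->
        measurable_fun setT (fun u => c t (fun i e => Y i e u)),
      forall t x x', {in entries t, forall p, x p.2 p.1 = x' p.2 p.1} ->
        c t x = c t x' &
      forall t e o s x, {in entries t, forall p, p.2 < s}%N ->
        (\int[nu e]_y (c (extend t s e o) (set_reward x s e y))%:E <= (c t x)%:E)%E].

Lemma set_reward_old x s e y (p : 'I_n * nat) : (p.2 < s)%N ->
  set_reward x s e y p.2 p.1 = x p.2 p.1.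
Proof. by move=> ps; rewrite /set_reward ltn_eqF. Qed.

Lemma eq_realize hs x x' : {in hs, forall p, x p.2 p.1 = x' p.2 p.1} ->
  realize hs x = realize hs x'.
Proof. by move=> xx'; apply/eq_in_map => p /xx' ->. Qed.

Lemma realize_set_reward hs s e x y : {in hs, forall p, p.2 < s}%N ->
  realize hs (set_reward x s e y) = realize hs x.
Proof.
by move=> hs_s; apply: eq_realize => p /hs_s; exact: set_reward_old.
Qed.

Lemma realize_rcons_set_reward hs s e x y : {in hs, forall p, p.2 < s}%N ->
  realize (rcons hs (e, s)) (set_reward x s e y) = rcons (realize hs x) (e, y).
Proof.
by move=> hs_s; rewrite realize_rcons realize_set_reward// /set_reward !eqxx.
Qed.

Lemma explored_supermartingale f : supermartingale nu f ->
  trace_supermartingale (fun t x => f (realize (explored t) x)).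
Proof.
move=> [f0 mf sf]; split=> [//|d T Y t mY|t x x' xx'|t e o s x ts].
- by apply: mf => p pt; apply: mY; rewrite mem_cat pt.
- by congr f; apply: eq_realize => p pt; apply: xx'; rewrite mem_cat pt.
have ets : {in explored t, forall p, p.2 < s}%N.
  by move=> p pt; apply: ts; rewrite mem_cat pt.
case: o => [MB|] /=.
  under eq_integral do rewrite realize_set_reward//.
  by rewrite integral_cst_probability.
under eq_integral do rewrite realize_rcons_set_reward//.
exact: sf.
Qed.

Lemma verified_supermartingale f : supermartingale nu f ->
  trace_supermartingale (fun t x => f (realize (verified t) x)).
Proof.
move=> [f0 mf sf]; split=> [//|d T Y t mY|t x x' xx'|t e o s x ts].
- by apply: mf => p pt; apply: mY; rewrite mem_cat pt orbT.
- by congr f; apply: eq_realize => p pt; apply: xx'; rewrite mem_cat pt orbT.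
have ets : {in verified t, forall p, p.2 < s}%N.
  by move=> p pt; apply: ts; rewrite mem_cat pt orbT.
case: o => [MB|] /=; last first.
  under eq_integral do rewrite realize_set_reward//.
  by rewrite integral_cst_probability.
under eq_integral do rewrite realize_rcons_set_reward//.
exact: sf.
Qed.

Lemma trace_reward_measurable c t e o s x : trace_supermartingale c ->
  measurable_fun setT (fun y => c (extend t s e o) (set_reward x s e y)).
Proof.
move=> [_ mc _ _]; apply: (mc _ _ (fun i e' y => set_reward x s e y i e')) => p _.
by rewrite /set_reward; case: (_ && _).
Qed.

Lemma trace_supermartingaleD c1 c2 : trace_supermartingale c1 ->
  trace_supermartingale c2 -> trace_supermartingale (fun t x => c1 t x + c2 t x).
Proof.
move=> c1S c2S; have [p1 m1 l1 s1] := c1S; have [p2 m2 l2 s2] := c2S.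
split=> [t x|d T Y t mY|t x x' xx'|t e o s x ts].
- by rewrite addr_ge0.
- exact: (measurable_funD (m1 _ _ _ _ mY) (m2 _ _ _ _ mY)).
- by rewrite (l1 _ _ _ xx') (l2 _ _ _ xx').
under eq_integral do rewrite EFinD.
rewrite ge0_integralD//; first exact: (leeD (s1 _ _ _ _ _ ts) (s2 _ _ _ _ _ ts)).
- by move=> y _; rewrite lee_fin.
- by apply/measurable_EFinP; exact: trace_reward_measurable.
- by move=> y _; rewrite lee_fin.
- by apply/measurable_EFinP; exact: trace_reward_measurable.
Qed.

Section Runs.
Variables (c : nat -> trace n -> (nat -> 'I_n -> R) -> R) (K : nat).
Hypothesis cS : forall j, trace_supermartingale (c j).

Let c_ge0 j t x : 0 <= c j t x. Proof. by case: (cS j). Qed.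

Let c_other D k e o j x y : valid D -> j != k ->
  c j (traces (perform D k (inr (e, o))) j) (set_reward x (drawn D) e y) =
  c j (traces D j) x.
Proof.
move=> vD jk; rewrite /= /set_trace (negbTE jk); have [_ _ lc _] := cS j.
by apply: lc => p /(vD j).1; exact: set_reward_old.
Qed.

Let c_self D k e o x : valid D ->
  (\int[nu e]_y (c k (traces (perform D k (inr (e, o))) k)
     (set_reward x (drawn D) e y))%:E <= (c k (traces D k) x)%:E)%E.
Proof.
move=> vD; rewrite /= /set_trace eqxx; have [_ _ _ sc] := cS k.
exact: sc (vD k).1.
Qed.

Let measurable_c_self D k e o x :
  measurable_fun setT (fun y => c k (traces (perform D k (inr (e, o))) k)
     (set_reward x (drawn D) e y)).
Proof. by rewrite /= /set_trace eqxx; exact: trace_reward_measurable. Qed.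

Let measurable_c d (T : measurableType d) (Y : nat -> 'I_n -> T -> R) D j :
  (forall k, {in entries (traces D k), forall p, measurable_fun setT (Y p.2 p.1)}) ->
  measurable_fun setT (fun t => c j (traces D j) (fun i e => Y i e t)).
Proof. by move=> mY; have [_ mc _ _] := cS j; exact: mc. Qed.

(* One timestep changes a single factor, so the product replaces independence of
   the copies, which share one adaptively consumed stream of rewards. *)
Lemma prod_run_supermartingale :
  run_supermartingale nu (fun D x => \prod_(j < K) c j (traces D j) x).
Proof.
split=> [D x|//|d T Y D mY|D k e o x vD].
- by apply: prodr_ge0.
- elim: K => [|K' IH].
    by rewrite (_ : (fun t => _) = cst 1)//; apply/funext => t; rewrite big_ord0.
  rewrite (_ : (fun t => _) = fun t =>
      \prod_(j < K') c j (traces D j) (fun i e => Y i e t) *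
      c K' (traces D K') (fun i e => Y i e t)).
    by apply: measurable_funM => //; exact: measurable_c.
  by apply/funext => t; rewrite big_ord_recr.
have [kK|Kk] := ltnP k K; last first.
  under eq_integral.
    move=> y _; rewrite (eq_bigr (fun j : 'I_K => c j (traces D j) x)); last first.
      by move=> j _; rewrite c_other// ltn_eqF// (leq_trans (ltn_ord j)).
    over.
  by rewrite integral_cst_probability.
under eq_integral.
  move=> y _; rewrite (bigD1 (Ordinal kK))//= mulrC.
  rewrite (eq_bigr (fun j : 'I_K => c j (traces D j) x)); last first.
    by move=> j jk; rewrite c_other.
  rewrite EFinM; over.
rewrite ge0_integralZl_EFin//.
- rewrite [in leRHS](bigD1 (Ordinal kK))//= mulrC EFinM.
  apply: lee_wpmul2l; last exact: c_self.
  by rewrite lee_fin; apply: prodr_ge0.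
- by move=> y _; rewrite lee_fin.
- by apply/measurable_EFinP; exact: measurable_c_self.
- by apply: prodr_ge0.
Qed.

Lemma sum_run_supermartingale :
  run_supermartingale nu (fun D x => \sum_(j < K) c j (traces D j) x).
Proof.
split=> [D x|//|d T Y D mY|D k e o x vD].
- by apply: sumr_ge0.
- elim: K => [|K' IH].
    by rewrite (_ : (fun t => _) = cst 0)//; apply/funext => t; rewrite big_ord0.
  rewrite (_ : (fun t => _) = fun t =>
      \sum_(j < K') c j (traces D j) (fun i e => Y i e t) +
      c K' (traces D K') (fun i e => Y i e t)).
    by apply: measurable_funD => //; exact: measurable_c.
  by apply/funext => t; rewrite big_ord_recr.
have [kK|Kk] := ltnP k K; last first.
  under eq_integral.
    move=> y _; rewrite (eq_bigr (fun j : 'I_K => c j (traces D j) x)); last first.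
      by move=> j _; rewrite c_other// ltn_eqF// (leq_trans (ltn_ord j)).
    over.
  by rewrite integral_cst_probability.
under eq_integral.
  move=> y _; rewrite (bigD1 (Ordinal kK))//=.
  rewrite (eq_bigr (fun j : 'I_K => c j (traces D j) x)); last first.
    by move=> j jk; rewrite c_other.
  rewrite EFinD; over.
rewrite ge0_integralD//.
- rewrite [in leRHS](bigD1 (Ordinal kK))//= EFinD integral_cst_probability.
  by apply: leeD2r; exact: c_self.
- by move=> y _; rewrite lee_fin.
- by apply/measurable_EFinP; exact: measurable_c_self.
- by move=> y _; rewrite lee_fin sumr_ge0.
Qed.

End Runs.
End TraceSupermartingales.

(** * Pathwise analysis *)

Section Slots.

Lemma count_slots j t : count_mem j (slots t) = (t %/ 2 ^ j)%N.
Proof.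
elim: t => [|t IH]; first by rewrite div0n.
rewrite slotsS count_cat IH divnS ?expn_gt0// addnC; congr (_ + _)%N.
rewrite count_filter.
have [div|ndiv] := boolP (2 ^ j %| t.+1)%N; last first.
  rewrite (@eq_count _ _ pred0) ?count_pred0// => i /=.
  by apply/negbTE/negP => /andP[/eqP->]; apply/negP.
rewrite (@eq_count _ _ (pred1 j)); last first.
  by move=> i /=; case: eqP => // ->.
rewrite count_uniq_mem ?iota_uniq// mem_iota /= add0n.
by rewrite (leq_trans (ltn_expl j (ltnSn 1)))// dvdn_leq.
Qed.

Lemma mem_slots_lt j t : j \in slots t -> (j < t)%N.
Proof.
rewrite -has_pred1 has_count count_slots divn_gt0 ?expn_gt0//.
exact/leq_trans/ltn_expl.
Qed.

(** A geometric sum of the counts [t %/ 2 ^ j]; [half] carries the tail [2 * (t %/ 2 ^ j)] to make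
    the induction close. *)
Lemma size_slots t : (size (slots t) <= 2 * t)%N.
Proof.
have -> : size (slots t) = (\sum_(j < t) count_mem (j : nat) (slots t))%N.
  have : {in slots t, forall j, j < t}%N by move=> j; exact: mem_slots_lt.
  elim: (slots t) => [|j s IH] st; first by rewrite big1.
  rewrite /= IH; last by move=> i si; apply: st; rewrite inE si orbT.
  rewrite -add1n big_split/=; congr (_ + _)%N.
  have jt : (j < t)%N by apply: st; rewrite mem_head.
  rewrite (bigD1 (Ordinal jt))//= eqxx big1 ?addn0// => i ij.
  by rewrite eq_sym; apply/eqP; rewrite eqb0; apply: contraNneq ij => ij; apply/eqP/val_inj.
under eq_bigr do rewrite count_slots.
have half j : (\sum_(i < j) t %/ 2 ^ i + t %/ 2 ^ j * 2 <= 2 * t)%N.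
  elim: j => [|j IH]; first by rewrite big_ord0 expn0 divn1; lia.
  rewrite big_ord_recr/= expnSr divnMA.
  apply: leq_trans IH; rewrite -addnA leq_add2l [leqRHS]muln2 -addnn.
  by rewrite leq_add2l leq_trunc_div.
exact: leq_trans (leq_addr _ _) (half t).
Qed.

End Slots.

Section Pathwise.
Context (R : realType) (n : nat).
Variables (F : {set {set 'I_n}}) (Mstar : {set 'I_n}) (w : 'I_n -> R) (sg : R).
Variables (sub : subroutines R n) (delta : R) (x : nat -> 'I_n -> R).
Hypothesis sg0 : 0 < sg.
Hypothesis F0 : finset.set0 \notin F.
Hypothesis Mstar_opt : unique_optimum F w Mstar.
Hypothesis sub_ok : subroutines_spec sub.
Hypothesis delta01 : 0 < delta < 100%:R^-1.

Local Notation deltaV k := (delta / 2 ^+ k.+1).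
Local Notation hE c := (realize (explored c) x).
Local Notation hV c := (realize (verified c) x).
Local Notation slot := (run_slot F sg sub delta x).

Lemma arms_gt0 : (0 < n)%N.
Proof.
have [MsF _] := Mstar_opt; have /set0Pn[e _] := feasible_neq0 F0 MsF.
exact: leq_ltn_trans (ltn_ord e).
Qed.

Lemma deltaV_bounds k : 0 < deltaV k <= 100%:R^-1.
Proof.
have /andP[d0 d1] := delta01.
rewrite divr_gt0// ?exprn_gt0//= ler_pdivrMr ?exprn_gt0//.
rewrite (le_trans (ltW d1))// ler_peMr ?invr_ge0// exprn_ege1//; lra.
Qed.

Lemma explore_initializes : initializes (explore F sg sub).
Proof.
move=> h hn; exists (Ordinal hn) => //.
by rewrite /explore insubT.
Qed.

Lemma verify_initializes eta M B : initializes (verify_fresh F sg sub eta M B).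
Proof.
move=> h hn; exists (Ordinal hn) => //.
by rewrite /verify_fresh insubT.
Qed.

Lemma explore_loop_explore h : (n <= size h)%N ->
  explore F sg sub h = explore_loop F sg sub h.
Proof. by move=> nh; rewrite /explore insubF// ltnNge nh. Qed.

Lemma verify_loop_verify eta M B h : (n <= size h)%N ->
  verify_fresh F sg sub eta M B h = verify_loop F sg sub eta M B h.
Proof. by move=> nh; rewrite /verify_fresh insubF// ltnNge nh. Qed.

Lemma ucb_lcb eta (h : history R n) e :
  ucb sg eta h e = lcb sg eta h e + 2 * Defs.rad sg eta h e.
Proof. by rewrite /ucb /lcb; lra. Qed.

Lemma explore_return_size h MB : explore F sg sub h = Return MB -> (n <= size h)%N.
Proof. by case: (leqP n (size h)) => // /explore_initializes[e ->]. Qed.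

Lemma verify_return_size eta M B h M' :
  verify_fresh F sg sub eta M B h = Return M' -> (n <= size h)%N.
Proof.
by case: (leqP n (size h)) => // /(verify_initializes eta M B)[e ->].
Qed.

Lemma explored_length h H : H = \sum_(e : 'I_n) cost F Mstar w sg e ->
  plays (explore F sg sub) h -> well_estimated w sg 100%:R^-1 h ->
  (size h)%:R <= 2 * n%:R + 9000 * (H * ln (n%:R / 100%:R^-1)) + 768 * (H * ln H).
Proof.
move=> HE ph we.
have eta1 : 0 < (100%:R^-1 : R) <= 100%:R^-1 by rewrite lexx andbT invr_gt0.
have HT : H = \sum_(e in [set: 'I_n]%SET) cost F Mstar w sg e.
  by rewrite HE; apply: eq_bigl => e; rewrite inE.
apply: (plays_length F0 Mstar_opt HT explore_initializes eta1 ph we).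
move=> g p pg ng weg; rewrite explore_loop_explore// /explore_loop.
case: ifPn => // big [pE]; split; first by rewrite inE.
apply: (explore_play_gap F0 Mstar_opt sub_ok (ucb_lcb 100%:R^-1 g) _ big (esym pE)).
by move=> e; exact: well_estimated_bounds.
Qed.

Lemma explore_output_sound h M B : explore F sg sub h = Return (M, B) ->
  well_estimated w sg 100%:R^-1 h ->
  [/\ M = Mstar,
      forall M', M' \in F -> ~~ (Mstar \subset M') ->
        exists2 e, e \in M' /\ e \in B &
        ((w e)%:E <= 2^-1%:E * (minW Mstar w + minW M' w))%E &
      forall e, e \in B -> exists M', [/\ M' \in F, ~~ (Mstar \subset M'),
        e \in M' & ((w e)%:E <= 2^-1%:E * (minW Mstar w + minW M' w))%E]].
Proof.
move=> ret we; have nh := explore_return_size ret; move: ret.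
rewrite explore_loop_explore// /explore_loop; case: ifPn => // small [<- <-].
have conf e := well_estimated_bounds e we nh.
have [h1 h2] := explore_return_bottleneck F0 Mstar_opt sub_ok conf small.
by split=> //; exact: (explore_return_opt F0 Mstar_opt sub_ok conf small).
Qed.

Lemma explore_return_feasible h M B :
  explore F sg sub h = Return (M, B) -> M \in F.
Proof.
move=> ret; have nh := explore_return_size ret; move: ret.
rewrite explore_loop_explore// /explore_loop; case: ifPn => // _ [<- _].
exact: (max_oracleF Mstar_opt sub_ok).
Qed.

Lemma verified_length eta h (B : {set 'I_n}) H :
  H = \sum_(e in Mstar :|: setN Mstar w) cost F Mstar w sg e ->
  0 < eta <= 100%:R^-1 ->
  (forall M', M' \in F -> ~~ (Mstar \subset M') ->
    exists2 e, e \in M' /\ e \in B &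
    ((w e)%:E <= 2^-1%:E * (minW Mstar w + minW M' w))%E) ->
  (forall e, e \in B -> exists M', [/\ M' \in F, ~~ (Mstar \subset M'),
    e \in M' & ((w e)%:E <= 2^-1%:E * (minW Mstar w + minW M' w))%E]) ->
  plays (verify_fresh F sg sub eta Mstar B) h -> well_estimated w sg eta h ->
  (size h)%:R <= 2 * n%:R + 9000 * (H * ln (n%:R / eta)) + 768 * (H * ln H).
Proof.
move=> HE eta1 B_hit B_from ph we.
apply: (plays_length F0 Mstar_opt HE (verify_initializes eta Mstar B)
  eta1 ph we) => //.
move=> g p pg ng weg; rewrite verify_loop_verify// /verify_loop.
case: ifPn => // big [pE].
apply: (verify_play_gap F0 Mstar_opt sub_ok (ucb_lcb eta g) _ B_hit B_from big (esym pE)).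
by move=> e; exact: well_estimated_bounds.
Qed.

Lemma verify_output_sound eta h M B M' : M \in F ->
  verify_fresh F sg sub eta M B h = Return M' -> well_estimated w sg eta h ->
  M' = Mstar.
Proof.
move=> MF ret we; have nh := verify_return_size ret; move: ret.
rewrite verify_loop_verify// /verify_loop; case: ifPn => // small [<-].
apply: (verify_return_opt Mstar_opt sub_ok _ MF small) => e.
exact: well_estimated_bounds.
Qed.

Definition trace_sound (k : nat) (c : trace n) : Prop :=
  [/\ plays (explore F sg sub) (hE c),
      explore_output c = None -> verified c = [::] &
      forall M B, explore_output c = Some (M, B) ->
        explore F sg sub (hE c) = Return (M, B) /\
        plays (verify_fresh F sg sub (deltaV k) M B) (hV c)].

Definition run_sound (D : run n) : Prop :=
  (forall k, trace_sound k (traces D k)) /\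
  forall M, output D = Some M -> exists k M' B,
    explore_output (traces D k) = Some (M', B) /\
    verify_fresh F sg sub (deltaV k) M' B (hV (traces D k)) = Return M.

Lemma run_sound_init : run_sound (run_init n).
Proof. by split=> // k; split=> //; exact: plays_nil. Qed.

Lemma decide_fresh_inr eta M B h e o :
  decide_fresh F sg sub eta M B h = inr (e, o) ->
  o = Some (M, B) /\ verify_fresh F sg sub eta M B h = Play e.
Proof. by rewrite /decide_fresh; case: verify_fresh => // e' [<- <-]. Qed.

Lemma decide_fresh_inl eta M B h M' :
  decide_fresh F sg sub eta M B h = inl M' ->
  verify_fresh F sg sub eta M B h = Return M'.
Proof. by rewrite /decide_fresh; case: verify_fresh => // ? [->]. Qed.

Lemma run_sound_slot D k : run_sound D -> run_sound (slot D k).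
Proof.
move=> [tD oD]; case outE : (output D) => [M0|].
  by rewrite (run_slot_stopped _ _ _ _ _ _ outE).
rewrite run_slot_running//.
have [pE ver0 out] := tD k.
have set_sound c j : trace_sound k c ->
    trace_sound j (set_trace D k c j).
  by move=> sc; rewrite /set_trace; case: eqP => [->|_].
case aE : decide => [M|[e o]] /=.
  split=> // _ [<-]; move: aE; rewrite /decide.
  case cE : (explore_output _) => [[M' B]|].
    by move=> /decide_fresh_inl ret; exists k, M', B.
  (* Verification cannot answer on an empty history, as [n > 0] initial plays come first; so an
     answering copy has already stored its exploration output. *)
  case: explore => // -[M' B] /decide_fresh_inl/verify_return_size.
  by rewrite leqNgt arms_gt0.
split=> // j; apply: set_sound.
move: aE; rewrite /decide /extend; case cE : (explore_output _) => [[M B]|].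
  move=> /decide_fresh_inr[-> ret]; split=> //= M' B' [<- <-].
  have [eE pV] := out _ _ cE; split=> //.
  by rewrite realize_rcons; exact: plays_rcons.
case eE : explore => [e'|[M B]].
  move=> [<- <-]; split=> //= [|_]; last exact: ver0.
  by rewrite realize_rcons; exact: plays_rcons.
move=> /decide_fresh_inr[-> ret]; split=> //= M' B' [<- <-].
split=> //; rewrite realize_rcons ver0//.
by apply: plays_rcons => //; exact: plays_nil.
Qed.

Lemma run_sound_slots D l : run_sound D -> run_sound (foldl slot D l).
Proof. by elim: l D => //= k l IH D sD; apply/IH/run_sound_slot. Qed.

Lemma output_foldl (D : run n) l M : output D = Some M -> foldl slot D l = D.
Proof.
elim: l D => //= k l IH D out.
by rewrite (run_slot_stopped _ _ _ _ _ _ out) IH.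
Qed.

Lemma size_entries_perform (D : run n) k e o j :
  size (entries (traces (perform D k (inr (e, o))) j)) =
  (size (entries (traces D j)) + (k == j))%N.
Proof.
rewrite /= /set_trace eq_sym; case: eqP => [->|_]; last by rewrite addn0.
rewrite /entries /extend; case: o => [MB|] /=; rewrite !size_cat size_rcons;
  by rewrite addn1 ?addnS ?addSn.
Qed.

(** While no answer is given, each slot of a copy yields exactly one sample, the change of phase
    included. A long unanswered run thus forces long histories. *)
Lemma size_entries_foldl D l j : output (foldl slot D l) = None ->
  size (entries (traces (foldl slot D l) j)) =
  (size (entries (traces D j)) + count_mem j l)%N.
Proof.
elim: l D => [|k l IH] D /= out; first by rewrite addn0.
have outD : output D = None.
  case outE : (output D) => [M|//]; move: out.
  rewrite (run_slot_stopped _ _ _ _ _ _ outE) (output_foldl _ outE) outE.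
  by [].
rewrite IH// addnA; congr (_ + _)%N; move: out.
rewrite run_slot_running//; case: decide => [M|[e o]] out.
  by rewrite (@output_foldl _ _ M) in out.
exact: size_entries_perform.
Qed.

Lemma size_entries_foldl_le D l j :
  (size (entries (traces (foldl slot D l) j)) <=
   size (entries (traces D j)) + count_mem j l)%N.
Proof.
elim: l D => [|k l IH] D /=; first by rewrite addn0.
apply: leq_trans (IH _) _; rewrite addnA leq_add2r.
case outE : (output D) => [M|].
  by rewrite (run_slot_stopped _ _ _ _ _ _ outE) leq_addr.
rewrite run_slot_running//; case: decide => [M|[e o]]; first by rewrite leq_addr.
by rewrite size_entries_perform.
Qed.

Lemma drawn_foldl_le D l : (drawn (foldl slot D l) <= drawn D + size l)%N.
Proof.
elim: l D => [|k l IH] D /=; first by rewrite addn0.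
apply: leq_trans (IH _) _; rewrite addnS -addSn leq_add2r.
case outE : (output D) => [M|].
  by rewrite (run_slot_stopped _ _ _ _ _ _ outE).
by rewrite run_slot_running//; case: decide => [M|[e o]] /=.
Qed.

Lemma drawn_foldl_ge D l : (drawn D <= drawn (foldl slot D l))%N.
Proof.
elim: l D => [|k l IH] D //=; apply: leq_trans (IH _).
case outE : (output D) => [M|].
  by rewrite (run_slot_stopped _ _ _ _ _ _ outE).
by rewrite run_slot_running//; case: decide => [M|[e o]] /=.
Qed.

Lemma explored_well_estimated m k c : trace_sound k c ->
  (size (explored c) <= m)%N -> deviation w sg 100%:R^-1 m (hE c) < 1 ->
  well_estimated w sg 100%:R^-1 (hE c).
Proof.
move=> [pE _ _] cm dev.
apply: (well_estimated_of_deviation sg0 arms_gt0 _ dev).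
- by rewrite lexx andbT invr_gt0.
- by rewrite size_realize.
move=> g g' hE ng e; apply: (nb_plays_gt0 explore_initializes) => //.
by move: pE; rewrite hE; exact: plays_prefix.
Qed.

Lemma verified_well_estimated m k c M B : trace_sound k c ->
  explore_output c = Some (M, B) ->
  (size (verified c) <= m)%N -> deviation w sg (deltaV k) m (hV c) < 1 ->
  well_estimated w sg (deltaV k) (hV c).
Proof.
move=> [_ _ out] cE cm dev; have [_ pV] := out _ _ cE.
apply: (well_estimated_of_deviation sg0 arms_gt0 (deltaV_bounds k) dev).
- by rewrite size_realize.
move=> g g' hE ng e; apply: (nb_plays_gt0 (verify_initializes (deltaV k) M B)) => //.
by move: pV; rewrite hE; exact: plays_prefix.
Qed.

(** Both deviations are nonnegative, so both phases are well estimated. Exploration pays for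
    [h1 + h2]; verification then starts from [Mstar] and a good [B], and pays for [h1] only. *)
Lemma trace_length m k c (h1 h2 Q : R) : trace_sound k c ->
  (size (entries c) <= m)%N ->
  h1 = \sum_(e in Mstar :|: setN Mstar w) cost F Mstar w sg e ->
  h2 = \sum_(e in setNt Mstar w) cost F Mstar w sg e ->
  Q = n%:R + (h1 * ln (delta^-1 * (n%:R * h1)) + h2 * ln (n%:R * h2)) ->
  deviation w sg 100%:R^-1 m (hE c) + deviation w sg (deltaV k) m (hV c) < 1 ->
  (size (entries c))%:R <= 1000 * 1000 * Q * k.+1%:R.
Proof.
move=> cS cm h1E h2E QE dev.
have h10 : 0 <= h1 by rewrite h1E sumr_ge0// => e _; exact: cost_ge0.
have h20 : 0 <= h2 by rewrite h2E sumr_ge0// => e _; exact: cost_ge0.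
have dev_ge0 eta h : 0 <= deviation w sg eta m h.
  do 3![apply: sumr_ge0 => ? _]; rewrite mulr_ge0 ?expR_ge0// addr_ge0//;
  exact: exp_mart_ge0.
have cmE : (size (explored c) <= m)%N.
  by apply: leq_trans cm; rewrite size_cat leq_addr.
have cmV : (size (verified c) <= m)%N.
  by apply: leq_trans cm; rewrite size_cat leq_addl.
have devE : deviation w sg 100%:R^-1 m (hE c) < 1.
  by have := dev_ge0 (deltaV k) (hV c); lra.
have devV : deviation w sg (deltaV k) m (hV c) < 1.
  by have := dev_ge0 100%:R^-1 (hE c); lra.
have weE := explored_well_estimated cS cmE devE.
have [pE ver0 out] := cS.
have HE : \sum_(e : 'I_n) cost F Mstar w sg e = h1 + h2.
  rewrite h1E h2E (bigID [in Mstar :|: setN Mstar w])/=; congr (_ + _).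
  apply: eq_bigl => e; rewrite !inE.
  by case: (e \in Mstar) => //=; rewrite -leNgt.
have lenE := explored_length (esym HE) pE weE; rewrite size_realize in lenE.
have [_ bnd] := sample_bounds k arms_gt0 delta01 h10 h20 QE (erefl _).
rewrite size_cat natrD; apply: le_trans bnd; apply: lerD => //.
case cE : (explore_output c) => [[M B]|]; last first.
  rewrite ver0//=; apply: le_trans (log_bound_ge1 arms_gt0 (deltaV_bounds k) h10).
  exact: ler01.
have [eE pV] := out _ _ cE.
have [MMs B_hit B_from] := explore_output_sound eE weE; subst M.
have weV := verified_well_estimated cS cE cmV devV.
have := verified_length h1E (deltaV_bounds k) B_hit B_from pV weV.
by rewrite size_realize.
Qed.

Lemma output_sound m D (M : {set 'I_n}) : run_sound D ->
  (forall k, size (entries (traces D k)) <= m)%N ->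
  (forall k, (0 < size (verified (traces D k)))%N ->
    deviation w sg (deltaV k) m (hV (traces D k)) < 1) ->
  output D = Some M -> M = Mstar.
Proof.
move=> [tD oD] Dm dev /oD[k [M' [B [cE ret]]]].
have [_ _ out] := tD k; have [eE _] := out _ _ cE.
have nV := verify_return_size ret; rewrite size_realize in nV.
apply: (verify_output_sound (explore_return_feasible eE) ret).
apply: (verified_well_estimated (m := m) (tD k) cE).
  by apply: leq_trans (Dm k); rewrite size_cat leq_addl.
by apply: dev; apply: leq_trans nV; exact: arms_gt0.
Qed.

End Pathwise.

(** * The parallel algorithm *)

Section Parallel.
Context (R : realType) (n : nat).
Variables (sg : R) (nu : 'I_n -> probability R R) (w : 'I_n -> R).
Variables (F : {set {set 'I_n}}) (Mstar : {set 'I_n}) (sub : subroutines R n).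
Context d (T : measurableType d) (P : probability T R).
Variables (X : nat -> 'I_n -> {RV P >-> R}) (delta : R).
Hypothesis sg0 : 0 < sg.
Hypothesis subG : forall e, sub_gaussian (nu e) (w e) sg.
Hypothesis F0 : finset.set0 \notin F.
Hypothesis Mstar_opt : unique_optimum F w Mstar.
Hypothesis sub_ok : subroutines_spec sub.
Hypothesis msub : subroutines_measurable sub.
Hypothesis rewards : reward_process nu X.
Hypothesis delta01 : 0 < delta < 100%:R^-1.

Local Notation deltaV k := (delta / 2 ^+ k.+1).
Let rw (t : T) (s : nat) (e : 'I_n) : R := X s e t.
Let D (t : nat) (u : T) := foldl (run_slot F sg sub delta (rw u)) (run_init n) (slots t).
Let n0 : (0 < n)%N := arms_gt0 F0 Mstar_opt.
Let eta01 : 0 < (100%:R^-1 : R) <= 100%:R^-1.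
Proof. by rewrite lexx andbT invr_gt0. Qed.

Let D_sound t u : run_sound F sg sub delta (rw u) (D t u).
Proof.
by apply: (run_sound_slots F0 Mstar_opt); exact: run_sound_init.
Qed.

Let D_entries t u k : (size (entries (traces (D t u) k)) <= size (slots t))%N.
Proof.
have := size_entries_foldl_le F sg sub delta (rw u) (run_init n) (slots t) k.
by move=> /leq_trans; apply; exact: count_size.
Qed.

Let measurable_event (Q : run n -> Prop) t : measurable [set u | Q (D t u)].
Proof.
apply: (@measurable_run R n F sg sub delta msub d T (fun i e => X i e)
  (fun D => [set _ | Q D])); [by []| |exact: valid_init].
move=> D' _; have [q|nq] := pselect (Q D').
  by rewrite (_ : [set _ | _] = setT)//; apply/seteqP; split.
by rewrite (_ : [set _ | _] = set0)//; apply/seteqP; split.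
Qed.

Let dev_ge0 eta m h : 0 <= deviation w sg eta m h.
Proof. by have [] := deviation_supermartingale subG eta m. Qed.

Variables (h1 h2 Q : R).
Hypothesis h1E : h1 = \sum_(e in Mstar :|: setN Mstar w) cost F Mstar w sg e.
Hypothesis h2E : h2 = \sum_(e in setNt Mstar w) cost F Mstar w sg e.
Hypothesis QE : Q = n%:R + (h1 * ln (delta^-1 * (n%:R * h1)) + h2 * ln (n%:R * h2)).

Lemma measurable_Z_event (Z : run n -> (nat -> 'I_n -> R) -> R) t :
  run_supermartingale nu Z -> measurable [set u | 1 <= Z (D t u) (rw u)].
Proof.
move=> ZS; have := @measurable_run R n F sg sub delta msub d T (fun i e => X i e)
  (fun E => [set u | 1 <= Z E (rw u)]) (run_init n) (slots t)
  (fun i e => measurable_funPT (X i e)).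
apply; last exact: valid_init.
move=> E _; rewrite -[X in measurable X]setTI.
have := measurable_run_supermartingale (P := P) X ZS E.
move=> /(_ measurableT `[1, +oo[%classic).
rewrite (_ : _ @^-1` _ = [set u | 1 <= Z E (rw u)]); first by apply.
by apply/seteqP; split=> u; rewrite /= in_itv/= andbT.
Qed.

(** In an unanswered run, each copy [j <= k] has drawn [t %/ 2 ^ j] samples, more than a
    well-estimated copy can, so every factor of [Z] is at least 1. Initially a factor is at most
    half of [1 / 100] plus half of [deltaV j]. *)
Lemma probability_unanswered t k :
  (forall j, (j <= k)%N -> 1000 * 1000 * Q * j.+1%:R < (t %/ 2 ^ j)%:R) ->
  (P [set u | output (D t u) = None] <= ((100%:R^-1) ^+ k.+1)%:E)%E.
Proof.
move=> tk; pose m := size (slots t).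
pose c j (tr : trace n) x : R := deviation w sg 100%:R^-1 m (realize (explored tr) x)
  + deviation w sg (deltaV j) m (realize (verified tr) x).
have cS j : trace_supermartingale nu (c j).
  apply: trace_supermartingaleD.
    exact/explored_supermartingale/deviation_supermartingale.
  exact/verified_supermartingale/deviation_supermartingale.
pose Z (E : run n) x : R := \prod_(j < k.+1) c j (traces E j) x.
have ZS : run_supermartingale nu Z by exact: prod_run_supermartingale.
apply: (@le_trans _ _ (P [set u | 1 <= Z (D t u) (rw u)])); last first.
  apply: (run_maximal_init F sg delta msub rewards ZS) => x.
  rewrite -[in leRHS](card_ord k.+1) -prodr_const; apply: ler_prod => j _.
  apply/andP; split; first by apply: addr_ge0.
  have h1' := deviation_nil w sg n0 eta01 m.
  have h2' := deviation_nil w sg n0 (deltaV_bounds delta01 j) m.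
  have /andP[_ dj] := deltaV_bounds delta01 j.
  by rewrite /c /=; lra.
apply: le_measure; rewrite ?inE;
  [exact: (measurable_event (fun E => output E = None))|exact: measurable_Z_event|].
move=> u /= out; rewrite -[leLHS](expr1n _ k.+1) -{1}(card_ord k.+1) -prodr_const.
apply: ler_prod => j _; rewrite ler01/= leNgt; apply/negP => dev.
have := trace_length sg0 F0 Mstar_opt sub_ok delta01 ((D_sound t u).1 j)
  (D_entries t u j) h1E h2E QE dev.
rewrite leNgt => /negP; apply.
rewrite size_entries_foldl//= add0n count_slots; apply: tk.
by rewrite -ltnS ltn_ord.
Qed.

(** Copies [j >= t] have no slot in the first [t] rounds, so the sum over [j < t] covers every copy
    that may answer; initially it is at most the geometric sum of [deltaV j / 2]. *)
Lemma probability_wrong_answer t :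
  (P [set u | exists2 M, output (D t u) = Some M & M != Mstar]
     <= (delta / 2)%:E)%E.
Proof.
pose m := size (slots t).
pose c j (tr : trace n) x : R := deviation w sg (deltaV j) m (realize (verified tr) x).
have cS j : trace_supermartingale nu (c j).
  exact/verified_supermartingale/deviation_supermartingale.
pose Z (E : run n) x : R := \sum_(j < t) c j (traces E j) x.
have ZS : run_supermartingale nu Z by exact: sum_run_supermartingale.
apply: (@le_trans _ _ (P [set u | 1 <= Z (D t u) (rw u)])); last first.
  apply: (run_maximal_init F sg delta msub rewards ZS) => x.
  have geom k : \sum_(j < k) deltaV j / 2 <= delta / 2 * (1 - (2 ^+ k)^-1).
    elim: k => [|k IH]; first by rewrite big_ord0 expr0 invr1 subrr mulr0.
    rewrite big_ord_recr/=; apply: le_trans (lerD IH (lexx _)) _.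
    have p0 : 0 < 2 ^+ k :> R by rewrite exprn_gt0.
    rewrite exprS; have -> : delta / (2 * 2 ^+ k) = delta * (2 ^+ k)^-1 / 2.
      by field; rewrite gt_eqF.
    have -> : (2 * 2 ^+ k)^-1 = (2 ^+ k)^-1 / 2 :> R by field; rewrite gt_eqF.
    lra.
  apply: (@le_trans _ _ (\sum_(j < t) deltaV j / 2)).
    apply: ler_sum => j _.
    exact: (deviation_nil w sg n0 (deltaV_bounds delta01 j) m).
  apply: le_trans (geom t) _; have /andP[dpos _] := delta01.
  have : 0 < (2 ^+ t)^-1 :> R by rewrite invr_gt0 exprn_gt0.
  by nra.
apply: le_measure; rewrite ?inE.
- exact: (measurable_event (fun E =>
    exists2 M, output E = Some M & M != Mstar)).
- exact: measurable_Z_event.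
move=> u /= [M out MMs]; rewrite leNgt; apply/negP => Zlt.
move/eqP: MMs; apply; apply: (output_sound sg0 F0 Mstar_opt sub_ok delta01 (D_sound t u)
  (D_entries t u) _ out) => k k0.
have kt : (k < t)%N.
  apply: mem_slots_lt; rewrite -has_pred1 has_count.
  have := size_entries_foldl_le F sg sub delta (rw u) (run_init n) (slots t) k.
  rewrite add0n; apply: leq_trans; apply: leq_trans k0 _.
  by rewrite size_cat leq_addl.
apply: le_lt_trans Zlt; rewrite /Z (bigD1 (Ordinal kt))//= lerDl.
by apply: sumr_ge0 => j _; exact: dev_ge0.
Qed.

Lemma probability_correct t k :
  (forall j, (j <= k)%N -> 1000 * 1000 * Q * j.+1%:R < (t %/ 2 ^ j)%:R) ->
  100%:R^-1 ^+ k.+1 <= delta / 2 ->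
  ((1 - delta)%:E <= P [set u | output (D t u) = Some Mstar])%E.
Proof.
move=> tk kd.
set A := [set u | output (D t u) = None].
set B := [set u | exists2 M, output (D t u) = Some M & M != Mstar].
set C := [set u | output (D t u) = Some Mstar].
have mA : measurable A by exact: (measurable_event (fun E => output E = None)).
have mB : measurable B.
  exact: (measurable_event (fun E => exists2 M, output E = Some M & M != Mstar)).
have mC : measurable C by exact: (measurable_event (fun E => output E = Some Mstar)).
have : (1%:E <= P C + (P A + P B))%E.
  rewrite -[leLHS](probability_setT P) [in leLHS](_ : setT = C `|` (A `|` B)).
    apply: le_trans (measureU2 _ mC (measurableU _ _ mA mB)) _.
    by apply: leeD2l; exact: measureU2.
  apply/seteqP; split=> // u _; rewrite /A /B /C /=.
  case: (output (D t u)) => [M|]; last by right; left.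
  have [->|MMs] := eqVneq M Mstar; first by left.
  by right; right; exists M.
have := probability_unanswered tk; rewrite -/A => PA.
have := probability_wrong_answer t; rewrite -/B => PB.
have PAB : (P A + P B <= delta%:E)%E.
  rewrite [delta]splitr EFinD; apply: leeD => //.
  by apply: le_trans PA _; rewrite lee_fin.
move=> h; have {}h := le_trans h (leeD2l _ PAB).
by rewrite EFinB leeBlDr.
Qed.

Lemma slots_le t t' : (t <= t')%N -> exists l, slots t' = slots t ++ l.
Proof.
elim: t' => [|t' IH]; first by rewrite leqn0 => /eqP->; exists [::].
rewrite leq_eqVlt ltnS => /predU1P[->|/IH[l lE]]; first by exists [::]; rewrite cats0.
by eexists; rewrite slotsS lE -catA.
Qed.

Let drawn_mono t t' u : (t <= t')%N -> (drawn (D t u) <= drawn (D t' u))%N.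
Proof.
by move=> /slots_le[l lE]; rewrite /D lE foldl_cat; exact: drawn_foldl_ge.
Qed.

Let drawn_answered t t' u M : output (D t u) = Some M -> (t <= t')%N ->
  drawn (D t' u) = drawn (D t u).
Proof.
move=> out /slots_le[l lE]; rewrite /D lE foldl_cat.
by rewrite (@output_foldl _ _ _ _ _ _ _ _ _ _ out).
Qed.

Let drawn_le t u : (drawn (D t u) <= 2 * t)%N.
Proof.
apply: leq_trans (size_slots t).
exact: (drawn_foldl_le F sg sub delta (rw u) (run_init n) (slots t)).
Qed.

Variable K : nat.
Hypothesis QK : 1000 * 1000 * Q < K%:R.

(* By round [N k] each of the copies [0, ..., k] has been resumed more often than
   a well-estimated copy can draw samples. *)
Let N k := (2 ^ k * (K * k.+1))%N.

Let N_large k j : (j <= k)%N -> 1000 * 1000 * Q * j.+1%:R < (N k %/ 2 ^ j)%:R.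
Proof.
move=> jk; apply: (@lt_le_trans _ _ (K * j.+1)%:R).
  by rewrite natrM ltr_pM2r.
rewrite ler_nat leq_divRL ?expn_gt0// mulnC /N.
by apply: leq_mul; [rewrite leq_exp2l|rewrite leq_mul2l ltnS jk orbT].
Qed.

Let N_mono k k' : (k <= k')%N -> (N k <= N k')%N.
Proof.
by move=> kk'; apply: leq_mul; [rewrite leq_exp2l|rewrite leq_mul2l ltnS kk' orbT].
Qed.

Let K_gt0 : (0 < K)%N.
Proof.
have h10 : 0 <= h1 by rewrite h1E sumr_ge0// => e _; exact: cost_ge0.
have h20 : 0 <= h2 by rewrite h2E sumr_ge0// => e _; exact: cost_ge0.
have [Q1 _] := sample_bounds 0 n0 delta01 h10 h20 QE (erefl _).
by rewrite -(ltr0n R); have := QK; lra.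
Qed.

Let N_ge k : (k <= N k)%N.
Proof.
rewrite /N; apply: (@leq_trans (2 ^ k * 1)); first by rewrite muln1 ltnW// ltn_expl.
by rewrite leq_mul2l muln_gt0 K_gt0 orbT.
Qed.

Let unanswered k := [set u | output (D (N k) u) = None].

(** Time is cut at the rounds [N k]: a run unanswered at [N k] is charged all of the at most
    [2 * N k.+1] samples drawn by [N k.+1]; an answered one draws no more. *)
Let drawn_bound t u : (drawn (D t u))%:R <=
  (2 * N 0)%:R + \sum_(k < t) (2 * N k.+1)%:R * \1_(unanswered k) u :> R.
Proof.
apply: (@le_trans _ _ (drawn (D (N t) u))%:R).
  by rewrite ler_nat drawn_mono.
elim: t => [|t IH]; first by rewrite big_ord0 addr0 ler_nat.
rewrite big_ord_recr /=; case outE : (output (D (N t) u)) => [M|].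
  rewrite (drawn_answered outE (N_mono (leqnSn t))) addrA.
  by apply: ler_wpDr => //; rewrite mulr_ge0.
have -> : \1_(unanswered t) u = 1 :> R by rewrite indicE mem_set.
rewrite mulr1 addrA; apply: ler_wpDl; last by rewrite ler_nat.
by rewrite addr_ge0// sumr_ge0// => k _; rewrite mulr_ge0.
Qed.

Let measurable_unanswered k : measurable (unanswered k).
Proof. exact: (measurable_event (fun E => output E = None)). Qed.

Let measurable_drawn t : measurable_fun setT (fun u => (drawn (D t u))%:R : R).
Proof.
move=> _ B mB; rewrite setTI.
exact: (measurable_event (fun E => B (drawn E)%:R)).
Qed.

Lemma expected_drawn t :
  (\int[P]_u ((drawn (D t u))%:R)%:E <= (4 * K%:R)%:E)%E.
Proof.
pose f u : R := (2 * N 0)%:R + \sum_(k < t) (2 * N k.+1)%:R * \1_(unanswered k) u.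
apply: (@le_trans _ _ (\int[P]_u (f u)%:E)%E).
  apply: ge0_le_integral => //.
  - exact/measurable_EFinP.
  - apply/measurable_EFinP; apply: measurable_funD => //.
    by apply: measurable_sum => k; exact: measurable_funM.
  - by move=> u _; rewrite lee_fin drawn_bound.
rewrite /f; under eq_integral do rewrite EFinD -sumEFin.
have mterm k : measurable_fun setT
    (fun u => ((2 * N k.+1)%:R * \1_(unanswered k) u : R)%:E).
  by apply/measurable_EFinP; exact: measurable_funM.
have term0 k u : (0 <= ((2 * N k.+1)%:R * \1_(unanswered k) u : R)%:E)%E.
  by rewrite lee_fin mulr_ge0.
rewrite ge0_integralD//; last 2 first.
- by move=> u _; exact: sume_ge0.
- exact: emeasurable_sum.
rewrite integral_cst_probability ge0_integral_sum//.
have termE k : (\int[P]_u ((2 * N k.+1)%:R * \1_(unanswered k) u : R)%:E <=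
    (2 * K%:R * (2 ^+ k.+1)^-1)%:E)%E.
  under eq_integral do rewrite EFinM.
  rewrite ge0_integralZl_EFin//; last first.
    exact/measurable_EFinP/measurable_indic/measurable_unanswered.
  rewrite integral_indic// setIT.
  apply: le_trans (lee_wpmul2l _ (probability_unanswered (N_large (k := k)))) _.
    by rewrite lee_fin.
  rewrite -EFinM lee_fin /N !natrM !natrX exprVn.
  have k2 : k.+2%:R <= 2 ^+ k.+1 :> R by rewrite -natrX ler_nat ltn_expl.
  have KR : 0 <= K%:R :> R by [].
  have p0 : 0 < 2 ^+ k.+1 :> R by rewrite exprn_gt0.
  (* Of [100 = 2 * 2 * 25], one 2 cancels the doubling in [N], the other absorbs [k.+2], and
     [25 >= 2] leaves a geometric series. *)
  have : (100 : R) ^+ k.+1 = 2 ^+ k.+1 * 2 ^+ k.+1 * 25 ^+ k.+1.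
    by rewrite -!exprMn; congr (_ ^+ _); lra.
  move=> ->; have q1 : 2 ^+ k.+1 <= 25 ^+ k.+1 :> R by rewrite lerXn2r ?nnegrE; lra.
  have r0 : 0 <= k.+2%:R :> R by [].
  move: r0 p0 k2 q1; move: (2 ^+ k.+1 : R) (25 ^+ k.+1 : R) (k.+2%:R : R).
  move=> p q r r0 p0 rp pq; have q0 : 0 < q by exact: lt_le_trans pq.
  have -> : 2 * (p * (K%:R * r)) * (p * p * q)^-1 = 2 * K%:R * (r / p * q^-1).
    by field; rewrite !gt_eqF.
  apply: ler_wpM2l; first by rewrite mulr_ge0.
  rewrite -[leRHS]mul1r; apply: ler_pM.
  - by rewrite divr_ge0// ltW.
  - by rewrite invr_ge0 ltW.
  - by rewrite ler_pdivrMr// mul1r.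
  - by rewrite lef_pV2 ?posrE.
apply: (@le_trans _ _ ((2 * N 0)%:R%:E +
    \sum_(k < t) (2 * K%:R * (2 ^+ k.+1)^-1)%:E)%E).
  by apply: leeD2l; apply: lee_sum => k _; exact: termE.
rewrite sumEFin -EFinD lee_fin.
have geom m : \sum_(k < m) 2 * K%:R * (2 ^+ k.+1)^-1 <= 2 * K%:R * (1 - (2 ^+ m)^-1) :> R.
  elim: m => [|m IH]; first by rewrite big_ord0 expr0 invr1 subrr mulr0.
  rewrite big_ord_recr/=; apply: le_trans (lerD IH (lexx _)) _.
  rewrite exprS; have -> : (2 * 2 ^+ m)^-1 = (2 ^+ m)^-1 / 2 :> R.
    by field; rewrite gt_eqF// exprn_gt0.
  lra.
have := geom t; have : 0 < (2 ^+ t)^-1 :> R by rewrite invr_gt0 exprn_gt0.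
have KR : 0 <= K%:R :> R by [].
by rewrite /N expn0 mul1n muln1 natrM; nra.
Qed.

(** The counts increase with the round, so monotone convergence carries the uniform bound of
    [expected_drawn] over to their supremum. *)
Lemma expected_samples :
  (\int[P]_u parallel_samples F sg sub delta (rw u) <= (4 * K%:R)%:E)%E.
Proof.
have mono u : {homo (fun t => ((drawn (D t u))%:R : R)%:E) :
    t t' / (t <= t')%N >-> (t <= t')%E}.
  by move=> t t' tt'; rewrite lee_fin ler_nat drawn_mono.
under eq_integral.
  move=> u _; rewrite (_ : parallel_samples _ _ _ _ _ =
      limn (fun t => ((drawn (D t u))%:R : R)%:E)); last first.
    rewrite (cvg_lim _ (ereal_nondecreasing_cvgn (mono u)))//.
    by congr ereal_sup; apply/seteqP; split=> _ [t _ <-]; exists t => //;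
      rewrite parallel_run_slots.
  over.
rewrite monotone_convergence//; last first.
  by move=> t; exact/measurable_EFinP.
apply: lime_le; last by apply: nearW => t; exact: expected_drawn.
apply: ereal_nondecreasing_is_cvgn => t t' tt'; apply: ge0_le_integral => //.
- exact/measurable_EFinP.
- exact/measurable_EFinP.
- by move=> u _; exact: mono.
Qed.

Lemma probability_returns : ((1 - delta)%:E <=
  P [set u | parallel_returns F sg sub delta (rw u) Mstar])%E.
Proof.
(* Having no answer by round [N k] gets half of the error budget; wrong answers take the other
   half. *)
have [k kd] : exists k, 100%:R^-1 ^+ k.+1 <= delta / 2.
  have /andP[dpos _] := delta01.
  have inv_le k : 100%:R^-1 ^+ k <= k.+1%:R^-1 :> R.
    rewrite exprVn lef_pV2 ?posrE ?exprn_gt0// -natrX ler_nat.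
    exact: ltn_expl.
  have := truncnS_gt (delta / 2)^-1; set k := Num.truncn _ => dk.
  exists k; apply: le_trans (inv_le k.+1) _.
  rewrite -[leRHS]invrK lef_pV2 ?posrE ?invr_gt0 ?divr_gt0//.
  by apply: le_trans (ltW dk) _; rewrite ler_nat.
apply: le_trans (probability_correct (N_large (k := k)) kd) _.
have retE : [set u | parallel_returns F sg sub delta (rw u) Mstar] =
    \bigcup_t [set u | output (D t u) = Some Mstar].
  by apply/seteqP; split=> u [t]; [rewrite parallel_run_slots => out; exists t
    |move=> _ out; exists t; rewrite parallel_run_slots].
have mE t : measurable [set u | output (D t u) = Some Mstar].
  exact: (measurable_event (fun E => output E = Some Mstar)).
apply: le_measure; rewrite ?inE//.
  by rewrite retE; exact: bigcupT_measurable.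
by rewrite retE => u out; exists (N k).
Qed.

End Parallel.

(** The summand [n] pays for initialization: if [F] contains only [Mstar], all gaps are infinite and
    [complexity] is 0, yet each arm is still played. *)
Theorem theorem2 (R : realType) :
  exists2 C : R, 0 < C &
  forall (n : nat) (sg : R) (nu : 'I_n -> probability R R) (w : 'I_n -> R)
    (F : {set {set 'I_n}}) (Mstar : {set 'I_n}) (sub : subroutines R n)
    (d : measure_display) (T : measurableType d) (P : probability T R)
    (X : nat -> 'I_n -> {RV P >-> R}) (delta : R),
  0 < sg ->
  (forall e, has_mean (nu e) (w e)) ->
  (forall e, sub_gaussian (nu e) (w e) sg) ->
  finset.set0 \notin F ->
  unique_optimum F w Mstar ->
  subroutines_spec sub ->
  subroutines_measurable sub ->
  reward_process nu X ->
  0 < delta < 100%:R^-1 ->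
  let rewards (omega : T) (s : nat) (e : 'I_n) : R := X s e omega in
  ((1 - delta)%:E <=
     P [set omega | parallel_returns F sg sub delta (rewards omega) Mstar])%E /\
  (\int[P]_omega parallel_samples F sg sub delta (rewards omega)
     <= C%:E * (n%:R%:E + complexity F Mstar w sg delta))%E.
Proof.
(* The expectation is at most [4 * K] with [K <= 1000 * 1000 * Q + 1]; the fifth million absorbs the
   leftover 4, thanks to [1 <= 4 * Q]. *)
exists (1000 * 1000 * 5); first lra.
move=> n sg nu w F Mstar sub d T P X delta sg0 _ subG F0 opt sub_ok msub rewards delta01 rw.
pose h1 : R := \sum_(e in Mstar :|: setN Mstar w) cost F Mstar w sg e.
pose h2 : R := \sum_(e in setNt Mstar w) cost F Mstar w sg e.
pose Q : R := n%:R + (h1 * ln (delta^-1 * (n%:R * h1)) + h2 * ln (n%:R * h2)).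
have h10 : 0 <= h1 by apply: sumr_ge0 => e _; exact: cost_ge0.
have h20 : 0 <= h2 by apply: sumr_ge0 => e _; exact: cost_ge0.
have n0 := arms_gt0 F0 opt.
have nR : 0 < n%:R :> R by rewrite ltr0n.
have /andP[d0 _] := delta01.
have [Q1 _] := sample_bounds 0 n0 delta01 h10 h20 (erefl Q) (erefl _).
have QK := truncnS_gt (1000 * 1000 * Q); set K := (Num.truncn _).+1 in QK.
split.
  exact: (probability_returns sg0 subG F0 opt sub_ok msub rewards delta01
    (erefl h1) (erefl h2) (erefl Q) QK).
have complexityE : (n%:R%:E + complexity F Mstar w sg delta)%E = Q%:E.
  have xlnxE (h c : R) : 0 <= h -> 0 < c -> (h%:E * lne (c * h)%:E)%E = (h * ln (c * h))%:E.
    rewrite le_eqVlt => /predU1P[<-|hp] c0; first by rewrite mul0e mul0r.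
    by rewrite lne_EFin ?mulr_gt0.
  rewrite /complexity !hardnessE// -/h1 -/h2 -!EFinM mulrA xlnxE//; last first.
    by rewrite mulr_gt0 ?invr_gt0.
  by rewrite xlnxE// -!EFinD /Q mulrA.
rewrite complexityE -EFinM.
apply: le_trans (expected_samples sg0 subG F0 opt sub_ok msub rewards delta01
  (erefl h1) (erefl h2) (erefl Q) QK) _.
rewrite lee_fin.
have Q0 : 0 <= 1000 * 1000 * Q by lra.
have : K%:R <= 1000 * 1000 * Q + 1.
  by rewrite /K -natr1 lerD2r truncn_le.
lra.
Qed.
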